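(* Consider the quadratic-bilinear (QB) system given by the real matrices $A,N_1,\dots,N_m\in\mathbb{R}^{n\times n}$, $H\in\mathbb{R}^{n\times n^2}$ (symmetric as a Hessian), $B\in\mathbb{R}^{n\times m}$, $C\in\mathbb{R}^{p\times n}$, with $A$ stable. (a) Assume that the reachability Gramian $P$ of the system is the solution of $$AP+PA^T+H(P\otimes P)H^T+\sum_{k=1}^mN_kPN_k^T+BB^T=0 .$$ If the target state $x_0$, to which the system is to be steered from $0$, satisfies $x_0\notin\operatorname{Im}P$, then $L_c(x_0)=\infty$, i.e. no input function $u$ steers the system from $0$ to $x_0$. (b) Consider furthermore the homogeneous QB system $$\dot x(t)=Ax(t)+H(x(t)\otimes x(t))+\sum_{k=1}^mN_kx(t)u_k(t),\qquad y(t)=Cx(t),\qquad x(0)=x_0,$$ and assume that $P>0$ (positive definite) and $Q$ are the reachability and observability Gramians of the QB system, being solutions of the equation in (a) and of $$A^TQ+QA+\mathcal{H}^{(2)}(P\otimes Q)(\mathcal{H}^{(2)})^T+\sum_{k=1}^mN_k^TQN_k+C^TC=0,$$ respectively. If the initial state satisfies $x_0\in\operatorname{Ker}Q$, then $L_o(x_0)=0$.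
   Context: The QB system is $\dot x(t)=Ax(t)+H(x(t)\otimes x(t))+\sum_{k=1}^m N_kx(t)u_k(t)+Bu(t)$, $y(t)=Cx(t)$, $x(0)=0$; $\otimes$ is the Kronecker product. A matrix is stable if all its eigenvalues have negative real part. $H$ is symmetric: $H(u\otimes v)=H(v\otimes u)$ for all $u,v\in\mathbb{R}^n$. Matricization: let $\mathcal{H}=(h_{ijk})\in\mathbb{R}^{n\times n\times n}$ be the tensor with $H_{i,(k-1)n+j}=h_{ijk}$; then $\mathcal{H}^{(2)}\in\mathbb{R}^{n\times n^2}$ is given by $\mathcal{H}^{(2)}_{j,(k-1)n+i}=h_{ijk}$, equivalently $\mathcal{H}^{(2)}(x\otimes z)=(x^T\otimes I_n)H^Tz$ for all $x,z\in\mathbb{R}^n$. Energy functionals. $L_c(x_0)=\min\frac12\int_{-\infty}^0\|u(t)\|^2dt$ over all $u\in L_2^m(-\infty,0]$ steering the QB system from $x(-\infty)=0$ to $x(0)=x_0$ ($=\infty$ if there is no such $u$). For the homogeneous system, $L_o(x_0)=\max\frac12\int_0^\infty\|y(t)\|^2dt$ over all $u\in\mathcal{B}_{(\alpha,\beta)}=\{u\in L_2^m[0,\infty):\|u\|_{L_2}\le\alpha,\|u\|_{L_\infty}\le\beta\}$ for which the trajectory with $x(0)=x_0$ satisfies $x(\infty)=0$; here $\alpha,\beta>0$ are given bounds. Gramians (brackets with commas denote horizontal concatenation). $\bar P_1(t_1)=e^{At_1}B$, $\bar P_2(t_1,t_2)=e^{At_2}[N_1,\dots,N_m](I_m\otimes\bar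 P_1(t_1))$, and for $i\ge3$ $$\bar P_i(t_1,\dots,t_i)=e^{At_i}\Big[H\big[\bar P_1(t_1)\otimes\bar P_{i-2}(t_2,\dots,t_{i-1}),\dots,\bar P_{i-2}(t_1,\dots,t_{i-2})\otimes\bar P_1(t_{i-1})\big],\ [N_1,\dots,N_m](I_m\otimes\bar P_{i-1}(t_1,\dots,t_{i-1}))\Big];$$ $\bar Q_1(t_1)=e^{A^Tt_1}C^T$, $\bar Q_2(t_1,t_2)=e^{A^Tt_2}[N_1^T,\dots,N_m^T](I_m\otimes\bar Q_1(t_1))$, and for $i\ge3$ $$\bar Q_i(t_1,\dots,t_i)=e^{A^Tt_i}\Big[\mathcal{H}^{(2)}\big[\bar P_1(t_1)\otimes\bar Q_{i-2}(t_2,\dots,t_{i-1}),\dots,\bar P_{i-2}(t_1,\dots,t_{i-2})\otimes\bar Q_1(t_{i-1})\big],\ [N_1^T,\dots,N_m^T](I_m\otimes\bar Q_{i-1}(t_1,\dots,t_{i-1}))\Big].$$ The inner lists run over $\bar P_j(t_1,\dots,t_j)\otimes\bar P_{i-1-j}(t_{j+1},\dots,t_{i-1})$, respectively $\bar P_j(t_1,\dots,t_j)\otimes\bar Q_{i-1-j}(t_{j+1},\dots,t_{i-1})$, $j=1,\dots,i-2$. The reachability Gramian is $P=\sum_{i\ge1}\int_0^\infty\cdots\int_0^\infty\bar P_i\bar P_i^Tdt_1\cdots dt_i$ and the observability Gramian is $Q=\sum_{i\ge1}\int_0^\infty\cdots\int_0^\infty\bar Q_i\bar Q_i^Tdt_1\cdots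 dt_i$; both are positive semidefinite symmetric whenever they exist. *)

(* Defs.v *)
From HB Require Import structures.
From mathcomp Require Import all_boot all_order all_algebra.
From mathcomp Require Import mxtens complex.
From mathcomp Require Import all_classical all_reals all_analysis.
Import Order.TTheory GRing.Theory Num.Theory.
Import numFieldNormedType.Exports.

Set Implicit Arguments.
Unset Strict Implicit.
Unset Printing Implicit Defensive.

Local Open Scope classical_set_scope.
Local Open Scope ring_scope.

Section Linear_algebra.
Context {R : realType}.

Definition stable_mx n (A : 'M[R]_n) : Prop :=
  forall z : R[i], eigenvalue (map_mx (real_complex R) A) z -> complex.Re z < 0.

Definition expmx n (A : 'M[R]_n) : 'M[R]_n :=
  limn (series (fun k => k`!%:R^-1 *: (A ^+ k))).

Definition posdef_mx n (P : 'M[R]_n) : Prop :=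
  P^T = P /\ forall v : 'cV[R]_n, v != 0 -> 0 < (v^T *m P *m v) 0 0.

(* The norm that the library puts on matrices is the maximum norm. *)
Definition enorm n (v : 'cV[R]_n) : R := Num.sqrt (\sum_i v i 0 ^+ 2).

(* [*t] is the Kronecker product, and [mxtens_index (k, j)] is the flattened
   index k * n + j (indices starting from 0). *)
Definition hessian_sym n (H : 'M[R]_(n, n * n)) : Prop :=
  forall u v : 'cV[R]_n, H *m (u *t v) = H *m (v *t u).

Definition hessian_tensor n (H : 'M[R]_(n, n * n)) (i j k : 'I_n) : R :=
  H i (mxtens_index (k, j)).

Definition mode2 n (H : 'M[R]_(n, n * n)) : 'M[R]_(n, n * n) :=
  \matrix_(j, q) let ki := mxtens_unindex q in hessian_tensor H ki.2 j ki.1.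

Definition hconcat n m (N : 'I_m -> 'M[R]_n) : 'M[R]_(n, m * n) :=
  \matrix_(i, q) N (mxtens_unindex q).1 i (mxtens_unindex q).2.

End Linear_algebra.

(* Matrices with n rows and any number of columns: the number of columns of the
   Gramian kernels is itself defined by recursion. *)
Record wmx (R : realType) (n : nat) :=
  Wmx { wcols : nat; wval :> 'M[R]_(n, wcols) }.

Section Wide_matrices.
Context {R : realType}.

Definition wcat n (s : seq (wmx R n)) : wmx R n :=
  foldr (fun X Y : wmx R n => Wmx (row_mx X Y)) (Wmx (0 : 'M[R]_(n, 0))) s.

Definition wmul n' n (M : 'M[R]_(n', n)) (X : wmx R n) : wmx R n' := Wmx (M *m X).

Definition wtens n n' (X : wmx R n) (Y : wmx R n') : wmx R (n * n') := Wmx (X *t Y).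

Definition wgram n (X : wmx R n) : 'M[R]_n := X *m X^T.

End Wide_matrices.

Record qb_system (R : realType) (n m p : nat) := QBSystem {
  qbA : 'M[R]_n;
  qbH : 'M[R]_(n, n * n);
  qbN : 'I_m -> 'M[R]_n;
  qbB : 'M[R]_(n, m);
  qbC : 'M[R]_(p, n)
}.

Section Gramians.
Context {R : realType} {n m p : nat} (sys : qb_system R n m p).

Let A := qbA sys.
Let H := qbH sys.
Let N := qbN sys.
Let B := qbB sys.
Let C := qbC sys.

(* The times t_1, ..., t_i are given as a list of length i. The kernels are
   defined by recursion on an upper bound [d] of the index i; [Pbar_ge3] and
   [Qbar_ge3] below give the recurrence without this bound. *)
Fixpoint Pbar_rec (d i : nat) (t : seq R) : wmx R n :=
  if d is d'.+1 then
    match i with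
    | 0 => wcat [::]
    | 1 => Wmx (expmx (t`_0 *: A) *m B)
    | 2 => wmul (expmx (t`_1 *: A))
             (wmul (hconcat N)
                (wtens (Wmx (1%:M : 'M[R]_m)) (Pbar_rec d' 1 (take 1 t))))
    | k.+3 => wmul (expmx (t`_k.+2 *: A)) (wcat [::
        wmul H (wcat [seq wtens (Pbar_rec d' j (take j t))
                                (Pbar_rec d' (k.+2 - j) (drop j (take k.+2 t)))
                     | j <- iota 1 k.+1]);
        wmul (hconcat N)
          (wtens (Wmx (1%:M : 'M[R]_m)) (Pbar_rec d' k.+2 (take k.+2 t)))])
    end
  else wcat [::].

Definition Pbar i t := Pbar_rec i i t.

Fixpoint Qbar_rec (d i : nat) (t : seq R) : wmx R n :=
  if d is d'.+1 then
    match i with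
    | 0 => wcat [::]
    | 1 => Wmx (expmx (t`_0 *: A^T) *m C^T)
    | 2 => wmul (expmx (t`_1 *: A^T))
             (wmul (hconcat (fun k => (N k)^T))
                (wtens (Wmx (1%:M : 'M[R]_m)) (Qbar_rec d' 1 (take 1 t))))
    | k.+3 => wmul (expmx (t`_k.+2 *: A^T)) (wcat [::
        wmul (mode2 H)
          (wcat [seq wtens (Pbar j (take j t))
                           (Qbar_rec d' (k.+2 - j) (drop j (take k.+2 t)))
                | j <- iota 1 k.+1]);
        wmul (hconcat (fun k => (N k)^T))
          (wtens (Wmx (1%:M : 'M[R]_m)) (Qbar_rec d' k.+2 (take k.+2 t)))])
    end
  else wcat [::].

Definition Qbar i t := Qbar_rec i i t.

Let Pbar_recS d k t : Pbar_rec d.+1 k.+3 t =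
  wmul (expmx (t`_k.+2 *: A)) (wcat [::
    wmul H (wcat [seq wtens (Pbar_rec d j (take j t))
                            (Pbar_rec d (k.+2 - j) (drop j (take k.+2 t)))
                 | j <- iota 1 k.+1]);
    wmul (hconcat N)
      (wtens (Wmx (1%:M : 'M[R]_m)) (Pbar_rec d k.+2 (take k.+2 t)))]).
Proof. by []. Qed.

Lemma Pbar_recE d i t : (i <= d)%N -> Pbar_rec d i t = Pbar i t.
Proof.
rewrite /Pbar.
suff E a b : (i <= a)%N -> (i <= b)%N -> Pbar_rec a i t = Pbar_rec b i t.
  by move=> id; exact: E.
elim: a b i t => [|a IH] [|b] [|[|[|k]]] t // ka kb.
  by rewrite /= (IH b).
rewrite !Pbar_recS (IH b) //.
congr (wmul _ (wcat [:: wmul _ (wcat _); _])).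
apply/eq_in_map => j; rewrite mem_iota => /andP[j1 jk].
have ja c : (k.+2 <= c)%N -> (j <= c)%N /\ (k.+2 - j <= c)%N.
  move=> kc; split; last exact: leq_trans (leq_subr _ _) kc.
  exact: leq_trans (ltnW jk) kc.
have [? ?] := ja _ ka; have [? ?] := ja _ kb.
by rewrite (IH b j) // (IH b (k.+2 - j)%N).
Qed.

Let Qbar_recS d k t : Qbar_rec d.+1 k.+3 t =
  wmul (expmx (t`_k.+2 *: A^T)) (wcat [::
    wmul (mode2 H) (wcat [seq wtens (Pbar j (take j t))
                            (Qbar_rec d (k.+2 - j) (drop j (take k.+2 t)))
                 | j <- iota 1 k.+1]);
    wmul (hconcat (fun k => (N k)^T))
      (wtens (Wmx (1%:M : 'M[R]_m)) (Qbar_rec d k.+2 (take k.+2 t)))]).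
Proof. by []. Qed.

Lemma Qbar_recE d i t : (i <= d)%N -> Qbar_rec d i t = Qbar i t.
Proof.
rewrite /Qbar.
suff E a b : (i <= a)%N -> (i <= b)%N -> Qbar_rec a i t = Qbar_rec b i t.
  by move=> id; exact: E.
elim: a b i t => [|a IH] [|b] [|[|[|k]]] t // ka kb.
  by rewrite /= (IH b).
rewrite !Qbar_recS (IH b) //.
congr (wmul _ (wcat [:: wmul _ (wcat _); _])).
apply/eq_in_map => j; rewrite mem_iota => /andP[j1 jk].
have ja c : (k.+2 <= c)%N -> (j <= c)%N /\ (k.+2 - j <= c)%N.
  move=> kc; split; last exact: leq_trans (leq_subr _ _) kc.
  exact: leq_trans (ltnW jk) kc.
have [? ?] := ja _ ka; have [? ?] := ja _ kb.
by rewrite (IH b (k.+2 - j)%N).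
Qed.

Lemma Pbar1 t : Pbar 1 t = Wmx (expmx (t`_0 *: A) *m B).
Proof. by []. Qed.

Lemma Pbar2 t : Pbar 2 t = wmul (expmx (t`_1 *: A))
  (wmul (hconcat N) (wtens (Wmx (1%:M : 'M[R]_m)) (Pbar 1 (take 1 t)))).
Proof. by []. Qed.

Lemma Pbar_ge3 i t : (3 <= i)%N -> Pbar i t =
  wmul (expmx (t`_i.-1 *: A)) (wcat [::
    wmul H (wcat [seq wtens (Pbar j (take j t))
                            (Pbar (i.-1 - j) (drop j (take i.-1 t)))
                 | j <- iota 1 (i - 2)]);
    wmul (hconcat N)
      (wtens (Wmx (1%:M : 'M[R]_m)) (Pbar i.-1 (take i.-1 t)))]).
Proof.
case: i => [|[|[|k]]] // _; rewrite {1}/Pbar Pbar_recS.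
congr (wmul _ (wcat [:: wmul _ (wcat _); _])).
apply/eq_in_map => j; rewrite mem_iota => /andP[j1 jk].
rewrite !Pbar_recE ?leq_subr //; exact: ltnW.
Qed.

Lemma Qbar1 t : Qbar 1 t = Wmx (expmx (t`_0 *: A^T) *m C^T).
Proof. by []. Qed.

Lemma Qbar2 t : Qbar 2 t = wmul (expmx (t`_1 *: A^T))
  (wmul (hconcat (fun k => (N k)^T))
     (wtens (Wmx (1%:M : 'M[R]_m)) (Qbar 1 (take 1 t)))).
Proof. by []. Qed.

Lemma Qbar_ge3 i t : (3 <= i)%N -> Qbar i t =
  wmul (expmx (t`_i.-1 *: A^T)) (wcat [::
    wmul (mode2 H) (wcat [seq wtens (Pbar j (take j t))
                                    (Qbar (i.-1 - j) (drop j (take i.-1 t)))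
                         | j <- iota 1 (i - 2)]);
    wmul (hconcat (fun k => (N k)^T))
      (wtens (Wmx (1%:M : 'M[R]_m)) (Qbar i.-1 (take i.-1 t)))]).
Proof.
case: i => [|[|[|k]]] // _; rewrite {1}/Qbar Qbar_recS.
congr (wmul _ (wcat [:: wmul _ (wcat _); _])).
apply/eq_in_map => j; rewrite mem_iota => /andP[j1 jk].
by rewrite Qbar_recE ?leq_subr.
Qed.

(* The iterated integral over [0, oo)^i: the innermost integration variable is
   t_1 and the outermost one is t_i. *)
Fixpoint iterint (i : nat) (f : seq R -> R) : R :=
  if i is i'.+1 then
    \int[lebesgue_measure]_(t in `[0, +oo[) iterint i' (fun s => f (rcons s t))
  else f [::].

Fixpoint iterintegrable (i : nat) (f : seq R -> R) : Prop :=
  if i is i'.+1 then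
    (forall t, 0 <= t -> iterintegrable i' (fun s => f (rcons s t))) /\
    lebesgue_measure.-integrable `[0, +oo[
      (fun t => (iterint i' (fun s => f (rcons s t)))%:E)
  else True.

(* G = \sum_(i >= 1) \int ... \int K_i K_i^T, all the integrals and the series
   being convergent. *)
Definition is_gramian (K : nat -> seq R -> wmx R n) (G : 'M[R]_n) : Prop :=
  (forall i, (1 <= i)%N ->
     forall a b, iterintegrable i (fun t => wgram (K i t) a b)) /\
  (fun l => \sum_(1 <= i < l)
     \matrix_(a, b) iterint i (fun t => wgram (K i t) a b)) @ \oo --> G.

Definition is_reachability_gramian (P : 'M[R]_n) := is_gramian Pbar P.

Definition is_observability_gramian (Q : 'M[R]_n) := is_gramian Qbar Q.

End Gramians.

Section Energy_functionals.
Context {R : realType} {n m p : nat} (sys : qb_system R n m p).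

Definition qb_field_hom (x : 'cV[R]_n) (u : 'cV[R]_m) : 'cV[R]_n :=
  qbA sys *m x + qbH sys *m (x *t x) + \sum_k u k 0 *: (qbN sys k *m x).

Definition qb_field (x : 'cV[R]_n) (u : 'cV[R]_m) : 'cV[R]_n :=
  qb_field_hom x u + qbB sys *m u.

(* As inputs are only square integrable, solutions are taken in the sense of
   Caratheodory: x is an indefinite integral of the right-hand side. *)
Definition is_trajectory (f : 'cV[R]_n -> 'cV[R]_m -> 'cV[R]_n) (D : set R)
    (u : R -> 'cV[R]_m) (x : R -> 'cV[R]_n) : Prop :=
  forall s t, D s -> D t -> s <= t -> forall i,
    lebesgue_measure.-integrable `[s, t] (fun r => (f (x r) (u r) i 0)%:E) /\
    x t i 0 = x s i 0 + \int[lebesgue_measure]_(r in `[s, t]) f (x r) (u r) i 0.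

(* The L_q norm over the time interval D. *)
Definition input_norm (q : \bar R) (D : set R) (u : R -> 'cV[R]_m) : \bar R :=
  Lnorm lebesgue_measure q ((fun t => (enorm (u t))%:E) \_ D).

Definition in_L2 (D : set R) (u : R -> 'cV[R]_m) : Prop :=
  (forall k, measurable_fun D (fun t => u t k 0)) /\
  (input_norm 2%:E D u < +oo)%E.

Definition energy k (D : set R) (w : R -> 'cV[R]_k) : \bar R :=
  (2^-1%:E * \int[lebesgue_measure]_(t in D) (enorm (w t) ^+ 2)%:E)%E.

Definition steers_to (x0 : 'cV[R]_n) (u : R -> 'cV[R]_m) : Prop :=
  in_L2 `]-oo, 0] u /\
  exists x, [/\ is_trajectory qb_field `]-oo, 0] u x,
                x @ -oo --> (0 : 'cV[R]_n) & x 0 = x0].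

Definition Lc (x0 : 'cV[R]_n) : \bar R :=
  ereal_inf [set energy `]-oo, 0] u | u in steers_to x0].

Definition admissible_input (alpha beta : R) (u : R -> 'cV[R]_m) : Prop :=
  [/\ in_L2 `[0, +oo[ u,
      (input_norm 2%:E `[0%R, +oo[ u <= alpha%:E)%E &
      (input_norm +oo `[0%R, +oo[ u <= beta%:E)%E].

Definition output_energies (alpha beta : R) (x0 : 'cV[R]_n) : set (\bar R) :=
  [set e | exists u x, [/\ admissible_input alpha beta u,
     is_trajectory qb_field_hom `[0, +oo[ u x,
     x 0 = x0, x @ +oo --> (0 : 'cV[R]_n) &
     e = energy `[0, +oo[ (fun t => qbC sys *m x t)]].

(* The supremum is taken in [0, +oo], so that it is 0 when no admissible input
   drives the state to 0. *)
Definition Lo (alpha beta : R) (x0 : 'cV[R]_n) : \bar R :=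
  ereal_sup (0%E |` output_energies alpha beta x0).

Definition reachability_equation (P : 'M[R]_n) : Prop :=
  qbA sys *m P + P *m (qbA sys)^T + qbH sys *m (P *t P) *m (qbH sys)^T
  + \sum_k qbN sys k *m P *m (qbN sys k)^T + qbB sys *m (qbB sys)^T = 0.

Definition observability_equation (P Q : 'M[R]_n) : Prop :=
  (qbA sys)^T *m Q + Q *m qbA sys
  + mode2 (qbH sys) *m (P *t Q) *m (mode2 (qbH sys))^T
  + \sum_k (qbN sys k)^T *m Q *m qbN sys k + (qbC sys)^T *m qbC sys = 0.

End Energy_functionals.

(* Main.v *)
(* Idea. If [e P = 0], multiplying the Lyapunov-type equation of [P] by [e] on
   the left and [e^T] on the right leaves a vanishing sum of positive
   semidefinite terms, so each of them vanishes. Hence [Im P] is invariant under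
   the dynamics, and so is [Ker Q] by the dual equation. For [w = E x], with
   [Ker E] the invariant subspace, this gives
   [|w' - A' w| <= c (|x| + |u|) |w|], where [A'] is the matrix induced by [A].
   - In (b), [w 0 = 0] and Gronwall's lemma give [w = 0], so that [C x = 0].
   - In (a), [A'] is stable and [w] tends to 0 at [-oo]. In a suitable norm an
     Euler step of fixed length [h] contracts strictly, and near [-oo] the
     perturbation over such a step is negligible, as [x] tends to 0 and [u] is
     square integrable. So [N (w t) <= N (w (t - j h))] for all [j], hence
     [w = 0] near [-oo], and Gronwall's lemma propagates this up to time 0. *)
Require Import Defs.
From mathcomp Require Import all_boot all_order all_algebra.
From mathcomp Require Import mxtens complex.
From mathcomp Require Import all_classical all_reals all_analysis.
From mathcomp Require Import ring lra spectral measurable_realfun.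
Import Order.TTheory GRing.Theory Num.Theory.
Import numFieldNormedType.Exports.
Local Open Scope classical_set_scope.
Local Open Scope ring_scope.

Set Implicit Arguments.
Unset Strict Implicit.
Unset Printing Implicit Defensive.

(** * Positive semidefinite matrices *)

Definition psd_mx (R : rcfType) n (P : 'M[R]_n) : Prop :=
  P^T = P /\ forall v : 'cV[R]_n, 0 <= (v^T *m P *m v) 0 0.

Lemma bilin_sym (R : rcfType) n (P : 'M[R]_n) (u v : 'cV[R]_n) :
  P^T = P -> (u^T *m P *m v) 0 0 = (v^T *m P *m u) 0 0.
Proof.
move=> symP; have -> : u^T *m P *m v = (v^T *m P *m u)^T.
  by rewrite !trmx_mul trmxK symP mulmxA.
by rewrite mxE.
Qed.

Lemma qformDZ (R : rcfType) n (P : 'M[R]_n) (u v : 'cV[R]_n) (c : R) : P^T = P ->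
  ((u + c *: v)^T *m P *m (u + c *: v)) 0 0 =
  (u^T *m P *m u) 0 0 + 2 * c * (u^T *m P *m v) 0 0 + c ^+ 2 * (v^T *m P *m v) 0 0.
Proof.
have symT : (u + c *: v)^T = u^T + c *: v^T by rewrite linearD linearZ.
move=> symP; rewrite symT !mulmxDl !mulmxDr -!scalemxAl -!scalemxAr.
have E := bilin_sym u v symP.
rewrite [LHS]mxE [X in X + _]mxE [X in _ + X]mxE.
rewrite 3![(_ *: _ : 'M[R]_1) _ _]mxE -[(v^T *m P *m u) 0 0]E.
rewrite [(_ *: _ : 'M[R]_1) _ _]mxE; ring.
Qed.

(** The form at [v + c *: w] is a nonnegative quadratic polynomial in [c] that vanishes at 0, so its
    linear coefficient is zero. Hence [P *m v] is orthogonal to every [w]. *)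
Lemma psd_ker (R : rcfType) n (P : 'M[R]_n) (v : 'cV[R]_n) :
  psd_mx P -> (v^T *m P *m v) 0 0 = 0 -> P *m v = 0.
Proof.
move=> [symP Ppos] v0.
have ort (w : 'cV_n) : (w^T *m P *m v) 0 0 = 0.
  set a := (X in X = 0); set b := (w^T *m P *m w) 0 0.
  have b0 : 0 <= b by exact: Ppos.
  (* The denominator is [b + 1] because [b] may be 0; the form then equals
     [- a ^+ 2 * (b + 2) / (b + 1) ^+ 2]. *)
  have := Ppos (v + (- a / (b + 1)) *: w).
  rewrite qformDZ // v0 bilin_sym // -/a -/b => h.
  have b1 : 0 < b + 1 by lra.
  have : 0 <= (a ^+ 2) * - (b + 2).
    have -> : a ^+ 2 * - (b + 2) =
      (0 + 2 * (- a / (b + 1)) * a + (- a / (b + 1)) ^+ 2 * b) * (b + 1) ^+ 2.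
      by field; rewrite gt_eqF.
    by rewrite mulr_ge0 // sqr_ge0.
  rewrite nmulr_lge0; last lra.
  by move=> ha; apply/eqP; rewrite -sqrf_eq0 eq_le ha sqr_ge0.
apply/matrixP => i j; rewrite ord1 [RHS]mxE -(ort (delta_mx i 0)).
by rewrite -mulmxA trmx_delta -rowE [RHS]mxE.
Qed.

(** Induction on the rank: the Schur complement [P'] is still positive semidefinite and also kills
    [v], so its rank is smaller; the subtracted rank-one term becomes one more column of [G]. *)
Lemma psd_factor (R : rcfType) n (P : 'M[R]_n) :
  psd_mx P -> exists k (G : 'M[R]_(n, k)), P = G *m G^T.
Proof.
move: {2}(\rank P).+1 (ltnSn (\rank P)) => r; elim: r P => // r IH P rP psdP.
have [->|P0] := eqVneq P 0.
  by exists 0%N, 0; rewrite mul0mx.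
have [symP Ppos] := psdP.
have [i Pi] : exists i, P *m delta_mx i (0 : 'I_1) != 0.
  apply/existsP; apply: contra_neqT P0 => /existsPn h.
  apply/matrixP => a i; have /eqP/matrixP/(_ a 0) := negbNE (h i).
  by rewrite -colE !mxE.
move: (delta_mx i 0) Pi => v Pv {i}.
pose q := (v^T *m P *m v) 0 0.
have q0 : 0 < q.
  by rewrite lt_neqAle Ppos andbT eq_sym; apply: contra Pv => /eqP/(psd_ker psdP)->.
pose P' := P - q^-1 *: (P *m v *m (P *m v)^T).
have qE : v^T *m (P *m v) = q%:M by rewrite mulmxA [LHS]mx11_scalar.
have vPE : (P *m v)^T = v^T *m P by rewrite trmx_mul symP.
have P'v : P' *m v = 0.
  rewrite mulmxBl -scalemxAl vPE -(mulmxA (P *m v)) -(mulmxA v^T) qE mul_mx_scalar.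
  by rewrite scalerA mulVf ?gt_eqF // scale1r subrr.
have P'P : (P' <= P)%MS.
  by rewrite addmx_sub // eqmx_opp scalemx_sub // vPE mulmxA submxMl.
have rP' : (\rank P' < r)%N.
  rewrite -ltnS (leq_trans _ rP) // ltnS (ltn_leqif (mxrank_leqif_sup P'P)).
  by apply: contra Pv => /submxP[D PD]; rewrite {1}PD -mulmxA P'v mulmx0.
have psdP' : psd_mx P'.
  split; first by rewrite linearB linearZ /= trmx_mul trmxK symP.
  move=> w; pose c := (w^T *m P *m v) 0 0.
  (* The factor [- c / q] minimises the form of [P] on the line through [w] directed by [v]; the
     minimum is the form of [P'] at [w]. *)
  have := Ppos (w + (- c / q) *: v); rewrite qformDZ // -/c -/q.
  suff -> : (w^T *m P' *m w) 0 0 = (w^T *m P *m w) 0 0 +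
     2 * (- c / q) * c + (- c / q) ^+ 2 * q by [].
  have cE : w^T *m (P *m v) = c%:M by rewrite mulmxA [LHS]mx11_scalar.
  have cE' : v^T *m P *m w = c%:M.
    by rewrite [LHS]mx11_scalar (bilin_sym v w symP).
  rewrite mulmxBr mulmxBl [LHS]mxE -addrA; congr (_ + _).
  rewrite [LHS]mxE vPE -scalemxAr -scalemxAl (mulmxA w^T) cE mul_scalar_mx -scalemxAl cE'.
  by rewrite !mxE eqxx mulr1n; field; rewrite gt_eqF.
have [k [G PG]] := IH _ rP' psdP'.
exists (1 + k)%N, (row_mx ((Num.sqrt q)^-1 *: (P *m v)) G).
rewrite tr_row_mx mul_row_col -PG linearZ /= -scalemxAl -scalemxAr scalerA.
by rewrite -invfM -expr2 sqr_sqrtr ?(ltW q0) // /P' addrC subrK.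
Qed.

Lemma psd_gram (R : rcfType) n k (G : 'M[R]_(n, k)) : psd_mx (G *m G^T).
Proof.
split=> [|v]; first by rewrite trmx_mul trmxK.
rewrite mulmxA -mulmxA -[G^T *m v]trmxK trmx_mul trmxK mxE.
by apply: sumr_ge0 => i _; rewrite [X in _ * X]mxE -expr2 sqr_ge0.
Qed.

(** Factoring both matrices as Gram matrices of [G] and [K] makes the product the Gram matrix of
    [G *t K]. *)
Lemma psd_tens (R : rcfType) n n' (P : 'M[R]_n) (Q : 'M[R]_n') :
  psd_mx P -> psd_mx Q -> psd_mx (P *t Q).
Proof.
move=> /psd_factor[a [G ->]] /psd_factor[b [K ->]].
by rewrite -tensmx_mul -trmx_tens; exact: psd_gram.
Qed.

Lemma congr_diagE (R : rcfType) n k (P : 'M[R]_n) (Y : 'M[R]_(k, n)) i :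
  (Y *m P *m Y^T) i i = (row i Y *m P *m (row i Y)^T) 0 0.
Proof. by rewrite -row_mul tr_row !mxE; apply: eq_bigr => j _; rewrite !mxE. Qed.

Lemma psd_congr_ge0 (R : rcfType) n k (P : 'M[R]_n) (Y : 'M[R]_(k, n)) i :
  psd_mx P -> 0 <= (Y *m P *m Y^T) i i.
Proof. by move=> [_ /(_ (row i Y)^T)]; rewrite congr_diagE trmxK. Qed.

(** Each diagonal entry is the form of [P] at a row of [Y], so [psd_ker] applies row by row. *)
Lemma psd_congr_eq0 (R : rcfType) n k (P : 'M[R]_n) (Y : 'M[R]_(k, n)) :
  psd_mx P -> (forall i, (Y *m P *m Y^T) i i = 0) -> Y *m P = 0.
Proof.
move=> psdP h; apply/row_matrixP => i; rewrite row0 row_mul.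
have [symP _] := psdP.
apply: trmx_inj; rewrite trmx0 trmx_mul symP; apply: (psd_ker psdP).
by rewrite trmxK -congr_diagE.
Qed.

(* Multiplying the equation by [E] on the left and by [E^T] on the right kills
   the first two terms, and leaves a sum of positive semidefinite ones. *)
Lemma gramian_equation_ker (R : rcfType) n m p k (A S X : 'M[R]_n)
    (M : 'M[R]_(n, n * n)) (N : 'I_m -> 'M[R]_n) (B : 'M[R]_(n, p))
    (E : 'M[R]_(k, n)) :
  psd_mx S -> psd_mx X ->
  A *m X + X *m A^T + M *m (S *t X) *m M^T + \sum_l N l *m X *m (N l)^T
    + B *m B^T = 0 ->
  E *m X = 0 ->
  [/\ E *m A *m X = 0, E *m M *m (S *t X) = 0,
      forall l, E *m N l *m X = 0 & E *m B = 0].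
Proof.
move=> psdS psdX eqX EX.
have [symX _] := psdX.
have XE : X *m E^T = 0 by rewrite -[X]symX -trmx_mul EX trmx0.
have psdT := psd_tens psdS psdX.
(* The identity is inserted between [B] and [B^T] so that this term too is a congruence of a
   positive semidefinite matrix. *)
have psd1 : psd_mx (1%:M : 'M[R]_p).
  by rewrite -[1%:M]mulmx1 -{2}trmx1; exact: psd_gram.
have sum0 i : (E *m M *m (S *t X) *m (E *m M)^T) i i
   + \sum_l (E *m N l *m X *m (E *m N l)^T) i i
   + (E *m B *m 1%:M *m (E *m B)^T) i i = 0.
  have := congr1 (fun Z => (E *m Z *m E^T) i i) eqX.
  rewrite mulmx0 mul0mx [RHS]mxE => eq0; rewrite -[RHS]eq0 {eq0}.
  rewrite !mulmxDr !mulmxDl !mulmxA EX !mul0mx -(mulmxA _ X) XE mulmx0 !add0r.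
  rewrite mulmx1 mulmx_sumr mulmx_suml !trmx_mul !mulmxA.
  rewrite [RHS]mxE [X in _ = X + _]mxE summxE; congr (_ + _ + _).
  by apply: eq_bigr => l _; rewrite !trmx_mul !mulmxA.
have sN0 i : 0 <= \sum_l (E *m N l *m X *m (E *m N l)^T) i i.
  by apply: sumr_ge0 => l _; exact: psd_congr_ge0.
have EM : E *m M *m (S *t X) = 0.
  apply: psd_congr_eq0 => // i; have := sum0 i.
  have := psd_congr_ge0 (E *m M) i psdT; have := psd_congr_ge0 (E *m B) i psd1.
  by have := sN0 i; lra.
have EB : E *m B = 0.
  rewrite -[E *m B]mulmx1; apply: psd_congr_eq0 => // i; have := sum0 i.
  have := psd_congr_ge0 (E *m M) i psdT; have := psd_congr_ge0 (E *m B) i psd1.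
  by have := sN0 i; lra.
have EN l : E *m N l *m X = 0.
  apply: psd_congr_eq0 => // i.
  have : \sum_l (E *m N l *m X *m (E *m N l)^T) i i = 0.
    have := sum0 i.
    have := psd_congr_ge0 (E *m M) i psdT; have := psd_congr_ge0 (E *m B) i psd1.
    by have := sN0 i; lra.
  move=> /eqP; rewrite psumr_eq0 => [/allP/(_ l)|j _]; last exact: psd_congr_ge0.
  by rewrite mem_index_enum => /(_ isT)/eqP.
(* Now [E] is applied on the left only: every term but [E *m A *m X] is already known to vanish. *)
split=> //; have := congr1 (mulmx E) eqX.
rewrite mulmx0 !mulmxDr !mulmxA EX EM EB !mul0mx !addr0 mulmx_sumr big1 ?addr0 //.
by move=> l _; rewrite !mulmxA EN mul0mx.
Qed.

Lemma posdef_psd (R : realType) n (P : 'M[R]_n) : posdef_mx P -> psd_mx P.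
Proof.
move=> [symP Ppos]; split=> // v; have [->|v0] := eqVneq v 0.
  by rewrite mulmx0 mxE.
exact/ltW/Ppos.
Qed.

Lemma posdef_unitmx (R : realType) n (P : 'M[R]_n) : posdef_mx P -> P \in unitmx.
Proof.
move=> [symP Ppos]; rewrite -row_free_unit -kermx_eq0.
apply: contraT => /rowV0Pn[v /sub_kermxP vP v0].
have := Ppos v^T; rewrite trmxK vP mul0mx mxE ltxx; apply.
by rewrite -trmx0 (inj_eq (@trmx_inj _ _ _)).
Qed.

(** * Iterated integrals and positivity of the Gramians *)

Section Linear_combinations.
Context d (T : measurableType d) (R : realType) (mu : {measure set T -> \bar R}).
Variables (D : set T) (mD : measurable D).
Variables (I : finType) (c : I -> R) (f : I -> T -> R).
Hypothesis intf : forall j, mu.-integrable D (fun x => (f j x)%:E).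

Lemma integrable_lincomb : mu.-integrable D (fun x => (\sum_j c j * f j x)%:E).
Proof.
have : mu.-integrable D (fun x => \sum_j ((c j)%:E * (f j x)%:E))%E.
  apply: integrable_sum => // j _.
  exact: integrableZl.
apply: eq_integrable => // x _.
by rewrite -sumEFin.
Qed.

Lemma Rintegral_lincomb :
  \int[mu]_(x in D) (\sum_j c j * f j x) = \sum_j c j * \int[mu]_(x in D) f j x.
Proof.
rewrite /Rintegral.
under eq_integral do rewrite -sumEFin.
rewrite integral_sum //; last first.
  move=> j; exact: (integrableZl mD (c j) (intf j)).
rewrite -sum_fine; last first.
  by move=> j _; apply: integrable_fin_num => //; exact: (integrableZl mD (c j) (intf j)).
by apply: eq_bigr => j _; exact: (RintegralZl (c j) mD (intf j)).
Qed.

End Linear_combinations.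

(** Lets a quadratic form, written as a linear combination of matrix entries, pass under the
    iterated integral. *)
Lemma iterint_lincomb (R : realType) (I : finType) i (c : I -> R)
    (f : I -> seq R -> R) :
  (forall j, iterintegrable i (f j)) ->
  iterint i (fun s => \sum_j c j * f j s) = \sum_j c j * iterint i (f j).
Proof.
elim: i f => [|i IH] f //= intf.
rewrite -Rintegral_lincomb //; last by move=> j; have [] := intf j.
apply: eq_Rintegral => t; rewrite inE /= in_itv /= andbT => t0.
by rewrite (IH (fun j s => f j (rcons s t))) // => j; have [+ _] := intf j; exact.
Qed.

Lemma iterint_ge0 (R : realType) i (f : seq R -> R) :
  (forall s, 0 <= f s) -> 0 <= iterint i f.
Proof.
elim: i f => [|i IH] f f0 //=; apply: Rintegral_ge0 => t _.
exact: IH.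
Qed.

Lemma quad_formE (R : comPzRingType) n (M : 'M[R]_n) (v : 'cV[R]_n) :
  (v^T *m M *m v) 0 0 = \sum_ab (v ab.1 0 * v ab.2 0) * M ab.1 ab.2.
Proof.
rewrite mxE -(pair_bigA _ (fun a b => v a 0 * v b 0 * M a b)) exchange_big /=.
apply: eq_bigr => b _; rewrite mxE mulr_suml; apply: eq_bigr => a _.
by rewrite !mxE mulrAC.
Qed.

(** The form of a partial sum is a sum of iterated integrals of forms of Gram matrices, which are
    nonnegative; symmetry and nonnegativity survive the entrywise limit. *)
Lemma gramian_psd (R : realType) n (K : nat -> seq R -> wmx R n) (G : 'M[R]_n) :
  is_gramian K G -> psd_mx G.
Proof.
move=> [intK]; set S := (fun l : nat => _) => cvgS.
have psdS l : psd_mx (S l).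
  split.
    rewrite linear_sum /=; apply: eq_bigr => i _; apply/matrixP => a b; rewrite !mxE.
    congr iterint; apply/funext => t.
    by rewrite /wgram -[in RHS](psd_gram _).1 [RHS]mxE.
  move=> v; rewrite mulmx_sumr mulmx_suml summxE big_seq; apply: sumr_ge0 => i.
  rewrite mem_index_iota => /andP[i1 _].
  rewrite quad_formE; under eq_bigr do rewrite mxE.
  rewrite -iterint_lincomb; last by move=> [a b]; exact: intK.
  by apply: iterint_ge0 => s; rewrite -quad_formE; have [_] := psd_gram (K i s).
have cvg_coord a b : (fun l => S l a b) @ \oo --> G a b.
  exact: (cvg_comp _ _ cvgS (@coord_continuous _ _ _ a b G)).
split.
  apply/matrixP => a b; rewrite mxE.
  have symS : (fun l => S l b a) = (fun l => S l a b).
    by apply/funext => l; rewrite -[in LHS](psdS l).1 mxE.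
  by apply: (cvg_unique _ _ (cvg_coord a b)) => //; rewrite -symS; exact: cvg_coord.
move=> v.
have cvgq : (fun l => (v^T *m S l *m v) 0 0) @ \oo --> (v^T *m G *m v) 0 0.
  rewrite quad_formE.
  under [fun l : nat => _]funext do rewrite quad_formE.
  apply: cvg_big => [|ab _]; first exact: add_continuous.
  by apply: cvgM; [exact: cvg_cst|exact: cvg_coord].
rewrite -(cvg_lim _ cvgq) //.
by apply: limr_ge; [exact: cvgP cvgq|apply: nearW => l; have [_] := psdS l].
Qed.

(** * A norm contracted by Euler steps *)

Lemma eigenvalue_trig (F : fieldType) n (T : 'M[F]_n) i :
  is_trig_mx T -> eigenvalue T (T i i).
Proof.
move=> trT; rewrite eigenvalue_root_char char_poly_trig //.
by rewrite /root horner_prod (bigD1 i) //= !hornerE subrr mul0r.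
Qed.

Lemma finite_pos_lower_bound (R : realDomainType) (I : finType) (f : I -> R) :
  (forall i, 0 < f i) -> exists2 a, 0 < a & forall i, a <= f i.
Proof.
move=> f0; exists (\big[Num.min/1]_i f i).
  by elim/big_ind : _ => // x y x0 y0; rewrite lt_min x0.
by move=> i; rewrite (bigD1 i) //= ge_min lexx.
Qed.

Import Normc.

Lemma normc_ge0 (R : rcfType) (z : R[i]) : 0 <= normc z.
Proof. by case: z => a b; exact: sqrtr_ge0. Qed.

Lemma normc_real (R : rcfType) (x : R) : normc (x%:C)%C = `|x|.
Proof. by rewrite /= expr0n addr0 sqrtr_sqr. Qed.

Lemma normc_sum (R : rcfType) (I : finType) (p : pred I) (f : I -> R[i]) :
  normc (\sum_(i | p i) f i) <= \sum_(i | p i) normc (f i).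
Proof.
elim/big_ind2 : _ => [|x a y b xa yb|//]; first by rewrite normc0.
by apply: le_trans (le_normcD _ _) _; exact: lerD.
Qed.

(** In [|1 + h z|^2 = 1 + 2 h Re z + h^2 |z|^2] the last two terms are at most [- 2 h a] and [h a],
    and [1 - h a <= (1 - h a / 2)^2]. *)
Lemma normc_euler_step (R : rcfType) (z : R[i]) (a h : R) :
  0 < a -> 0 < h -> complex.Re z <= - a -> h * a <= 1 -> h * normc z ^+ 2 <= a ->
  normc (1 + (h%:C)%C * z) <= 1 - h * a / 2.
Proof.
case: z => x y /= a0 h0 xa ha; rewrite sqr_sqrtr ?addr_ge0 ?sqr_ge0 // => hL.
have -> : 1 - h * a / 2 = Num.sqrt ((1 - h * a / 2) ^+ 2).
  by rewrite sqrtr_sqr ger0_norm //; lra.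
rewrite ler_wsqrtr // !mul0r subr0 add0r addr0.
have : h * x <= - (h * a) by rewrite -mulrN ler_pM2l.
have : h * (h * (x ^+ 2 + y ^+ 2)) <= h * a by rewrite ler_pM2l.
have := sqr_ge0 (h * a).
by rewrite !expr2; nra.
Qed.

(* The norm is a weighted l1 norm in coordinates where [A] is triangular:
   geometric weights of small ratio [d] make the off-diagonal part negligible. *)
Lemma stable_contraction_norm (R : rcfType) n (A : 'M[R]_n) :
  (forall z, eigenvalue (map_mx (real_complex R) A) z -> complex.Re z < 0) ->
  exists (N : 'cV[R]_n -> R) (c h0 K : R), [/\ 0 < c, 0 < h0 & 0 <= K] /\
  [/\ forall v, 0 <= N v,
      forall u v, N (u + v) <= N u + N v,
      forall (v : 'cV[R]_n) i, `|v i 0| <= N v,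
      forall (v : 'cV[R]_n) b, (forall i, `|v i 0| <= b) -> N v <= K * b &
      forall h v, 0 < h -> h <= h0 ->
        N (v + h *: (A *m v)) <= (1 - h * c) * N v].
Proof.
case: n A => [|n] A.
  (* In dimension 0 the zero function is a norm; [Schur] below asks for a positive dimension. *)
  move=> _; exists (fun=> 0), 1, 1, 0; split; first by split; rewrite ?ltr01.
  by split=> [//|u v|v []//|v b _|h v _ _]; rewrite ?addr0 ?mul0r ?mulr0.
move=> stA; pose toC m1 m2 (M : 'M[R]_(m1, m2)) := map_mx (real_complex R) M.
have [P uniP] := Schur (toC _ _ A) (ltn0Sn n).
have {uniP} uP : P \in unitmx by exact: unitarymx_unit.
rewrite /similar_to /=; set T := conjmx P _ => trT.
have PA : P *m toC _ _ A = T *m P by rewrite /T conjumx // mulmxKV.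
have reT i : complex.Re (T i i) < 0.
  apply/stA/(@eigenvalue_conjmx _ _ _ P); last exact: eigenvalue_trig.
    by rewrite stablemx_unit.
  by rewrite row_free_unit.
have [a a0 aT] : exists2 a, 0 < a & forall i, complex.Re (T i i) <= - a.
  have [|a a0 aT] := @finite_pos_lower_bound _ _ (fun i => - complex.Re (T i i)).
    by move=> i; rewrite oppr_gt0.
  by exists a => // i; rewrite lerNr.
pose L := 1 + \sum_i normc (T i i) ^+ 2.
have LT i : normc (T i i) ^+ 2 <= L.
  rewrite /L (bigD1 i) //= addrCA lerDl addr_ge0 // sumr_ge0 // => j _.
  exact: sqr_ge0.
have L0 : 0 < L by rewrite ltr_pwDl // sumr_ge0 // => i _; exact: sqr_ge0.
pose tau := 1 + \sum_i \sum_j normc (T i j).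
have tau0 : 0 < tau.
  by rewrite ltr_pwDl // sumr_ge0 // => i _; rewrite sumr_ge0 // => j _; exact: normc_ge0.
(* The bound [d * tau <= a / 4] makes the off-diagonal part cost at most half of the decay rate
   [a / 2] of the diagonal. *)
pose d := Num.min 1 (a / 4 / tau).
have d0 : 0 < d by rewrite lt_min ltr01 !divr_gt0.
have d1 : d <= 1 by rewrite ge_min lexx.
have dtau : d * tau <= a / 4 by rewrite -ler_pdivlMr // ge_min lexx orbT.
pose y (v : 'cV[R]_n.+1) i := normc ((P *m toC _ _ v) i 0).
pose N0 (v : 'cV[R]_n.+1) := \sum_(i < n.+1) d ^+ i * y v i.
have y0 v i : 0 <= y v i by exact: normc_ge0.
pose Pi := invmx P.
(* This factor undoes the change of basis and the weights, so that [kap * N0 v] dominates every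
   coordinate of [v]. *)
pose kap := 1 + \sum_i \sum_(j < n.+1) normc (Pi i j) / d ^+ j.
have kt0 i j : 0 <= normc (Pi i j) / d ^+ (j : 'I_n.+1).
  by rewrite divr_ge0 ?normc_ge0 // exprn_ge0 // ltW.
have kap0 : 0 < kap.
  by rewrite ltr_pwDl // sumr_ge0 // => i _; rewrite sumr_ge0.
pose K := \sum_(i < n.+1) d ^+ i * \sum_j normc (P i j).
have N0K (v : 'cV[R]_n.+1) b : (forall i, `|v i 0| <= b) -> N0 v <= K * b.
  move=> vb; rewrite /N0 /K mulr_suml; apply: ler_sum => i _.
  rewrite -mulrA ler_pM2l ?exprn_gt0 // /y mxE (le_trans (normc_sum _ _)) //.
  rewrite mulr_suml; apply: ler_sum => j _; rewrite normcM mxE normc_real.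
  by rewrite ler_wpM2l ?normc_ge0.
have N0v (v : 'cV[R]_n.+1) i : `|v i 0| <= kap * N0 v.
  have -> : `|v i 0| = normc ((Pi *m (P *m toC _ _ v)) i 0).
    by rewrite mulKmx // mxE normc_real.
  rewrite mxE (le_trans (normc_sum _ _)) // /N0 mulr_sumr.
  apply: ler_sum => j _; rewrite normcM -/(y v j).
  rewrite mulrA ler_wpM2r // -ler_pdivrMr ?exprn_gt0 // /kap.
  apply: le_trans (_ : \sum_(k < n.+1) normc (Pi i k) / d ^+ k <= _).
    by rewrite (bigD1 j) //= lerDl sumr_ge0.
  rewrite [X in _ <= _ + X](bigD1 i) //= addrCA lerDl addr_ge0 // sumr_ge0 // => k _.
  exact: sumr_ge0.
have N0D u v : N0 (u + v) <= N0 u + N0 v.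
  rewrite /N0 -big_split /=; apply: ler_sum => i _.
  rewrite -mulrDr ler_pM2l ?exprn_gt0 // /y /toC map_mxD mulmxDr mxE.
  exact: le_normcD.
have N0ge0 v : 0 <= N0 v.
  by apply: sumr_ge0 => i _; rewrite mulr_ge0 // exprn_ge0 // ltW.
have N0h h v : 0 < h -> h * a <= 1 -> h * L <= a ->
    N0 (v + h *: (A *m v)) <= (1 - h * (a / 4)) * N0 v.
  move=> h0 ha hL.
  have yh i : y (v + h *: (A *m v)) i <= (1 - h * a / 2) * y v i +
      h * \sum_(j < n.+1 | (j < i)%N) normc (T i j) * y v j.
    rewrite /y /toC map_mxD map_mxZ map_mxM mulmxDr -scalemxAr.
    rewrite (mulmxA P) PA -mulmxA.
    move: (P *m _) => w; rewrite [(_ + _ : matrix _ _ _) i 0]mxE.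
    rewrite [(_ *: _ : matrix _ _ _) i 0]mxE [(T *m w) i 0]mxE.
    rewrite (bigD1 i) //= mulrDr addrA.
    rewrite mulrA -{1}(mul1r (w i 0)) -mulrDl.
    rewrite (le_trans (le_normcD _ _)) // lerD //.
      rewrite normcM ler_wpM2r ?normc_ge0 //.
      apply: (normc_euler_step a0 h0 (aT i)) => //.
      by apply: le_trans hL; rewrite ler_pM2l.
    rewrite normcM normc_real gtr0_norm // ler_pM2l //.
    rewrite (le_trans (normc_sum _ _)) // [leRHS]big_mkcond [leLHS]big_mkcond.
    apply: ler_sum => j _; case: (ltngtP j i) => [ji|ij|/val_inj ->].
    - by rewrite -(inj_eq val_inj) ltn_eqF //= normcM.
    - rewrite (is_trig_mxP trT) // mul0r normc0; by case: ifP.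
    - by rewrite eqxx.
  (* [T] is lower triangular: only [j < i] occurs, and then [d ^+ i <= d * d ^+ j], which gains one
     factor [d]. *)
  have low (i : 'I_n.+1) :
      d ^+ i * (\sum_(j < n.+1 | (j < i)%N) normc (T i j) * y v j) <=
      \sum_(j < n.+1) d * normc (T i j) * (d ^+ j * y v j).
    rewrite mulr_sumr [leLHS]big_mkcond; apply: ler_sum => j _; case: ifP => ji.
      rewrite [leLHS]mulrA [leRHS]mulrA ler_wpM2r //.
      rewrite mulrC -mulrA mulrCA ler_wpM2l ?normc_ge0 // -exprS.
      by rewrite ler_wiXn2l // ltW.
    by rewrite !mulr_ge0 // ?normc_ge0 ?exprn_ge0 // ltW.
  have colT j : \sum_i normc (T i j) <= tau.
    rewrite /tau ler_wpDl // ler_sum // => i _.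
    by rewrite (bigD1 j) //= lerDl sumr_ge0 // => k _; exact: normc_ge0.
  apply: (@le_trans _ _ ((1 - h * a / 2) * N0 v + h * (d * tau * N0 v))).
    rewrite (mulr_sumr _ _ _ (1 - h * a / 2)).
    apply: (@le_trans _ _ (\sum_(i < n.+1) ((1 - h * a / 2) * (d ^+ i * y v i) +
        h * \sum_(j < n.+1) d * normc (T i j) * (d ^+ j * y v j)))).
      apply: ler_sum => i _.
      apply: le_trans (_ : d ^+ i * ((1 - h * a / 2) * y v i +
        h * \sum_(j < n.+1 | (j < i)%N) normc (T i j) * y v j) <= _).
        by rewrite ler_wpM2l // exprn_ge0 // ltW.
      by rewrite mulrDr mulrCA lerD2l mulrCA ler_pM2l.
    rewrite big_split /= lerD2l -mulr_sumr ler_pM2l // exchange_big /= mulr_sumr.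
    apply: ler_sum => j _; rewrite -mulr_suml -mulr_sumr ler_wpM2r //.
      by rewrite mulr_ge0 // exprn_ge0 // ltW.
    by rewrite ler_pM2l.
  have : d * tau * N0 v <= a / 4 * N0 v by rewrite ler_wpM2r.
  by rewrite -(ler_pM2l h0); lra.
exists (fun v => kap * N0 v), (a / 4), (Num.min a^-1 (a / L)), (kap * K).
split.
  split; first by rewrite divr_gt0.
    by rewrite lt_min invr_gt0 a0 divr_gt0.
  rewrite mulr_ge0 ?(ltW kap0) // sumr_ge0 // => i _.
  rewrite mulr_ge0 ?exprn_ge0 ?(ltW d0) // sumr_ge0 // => j _; exact: normc_ge0.
split=> // [v|u v|v b vb|h v h0].
- by rewrite mulr_ge0 ?(ltW kap0) // N0ge0.
- by rewrite -mulrDr ler_pM2l.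
- by rewrite -mulrA ler_pM2l // N0K.
- rewrite le_min => /andP[ha hL]; rewrite mulrCA ler_pM2l // N0h //.
    by rewrite -ler_pdivlMr // mul1r.
  by rewrite -ler_pdivlMr.
Qed.

(** * Gronwall estimates *)

Lemma cV_norm_le (R : realType) n (v : 'cV[R]_n) b :
  0 <= b -> (forall i, `|v i 0| <= b) -> `|v| <= b.
Proof.
move=> b0 vb; rewrite [leLHS]/Num.norm /= mx_normrE.
by apply: bigmax_le => // -[i j] _ /=; rewrite ord1.
Qed.

Lemma le_cV_norm (R : realType) n (v : 'cV[R]_n) i : `|v i 0| <= `|v|.
Proof.
rewrite [leRHS]/Num.norm /= mx_normrE.
exact: (le_bigmax _ (fun ij : 'I_n * 'I_1 => `|v ij.1 ij.2|) (i, 0)).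
Qed.

Lemma mulmx_norm_bound (R : realType) m n (M : 'M[R]_(m, n)) :
  exists2 K, 0 <= K & forall v : 'cV_n, `|M *m v| <= K * `|v|.
Proof.
exists (\sum_i \sum_j `|M i j|) => [|v].
  by apply: sumr_ge0 => i _; apply: sumr_ge0.
apply: cV_norm_le => [|i].
  by rewrite mulr_ge0 // sumr_ge0 // => i _; exact: sumr_ge0.
rewrite mxE (le_trans (ler_norm_sum _ _ _)) // (bigD1 i) //= mulrDl.
apply: ler_wpDr.
  by rewrite mulr_ge0 // sumr_ge0 // => j _; exact: sumr_ge0.
rewrite mulr_suml; apply: ler_sum => j _; rewrite normrM.
by rewrite ler_wpM2l // le_cV_norm.
Qed.

Lemma tens_colE (R : pzRingType) m n (u : 'cV[R]_m) (v : 'cV[R]_n) i j :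
  (u *t v : 'cV_(m * n)) (mxtens_index (i, j)) 0 = u i 0 * v j 0.
Proof.
rewrite -[RHS](tensmxE u v); congr (fun_of_matrix _ _ _).
by apply: val_inj.
Qed.

Lemma tens_norm_le (R : realType) m n (u : 'cV[R]_m) (v : 'cV[R]_n) :
  `|u *t v : 'cV_(m * n)| <= `|u| * `|v|.
Proof.
apply: cV_norm_le => [|i]; first by rewrite mulr_ge0.
case: (mxtens_indexP i) => i1 i2.
by rewrite tens_colE normrM ler_pM // le_cV_norm.
Qed.

Section Short_intervals.
Context {R : realType}.
Notation mu := (@lebesgue_measure R).

Lemma normr_Rintegral_le (a s t b : R) (g L : R -> R) :
  a <= s -> t <= b ->
  mu.-integrable `[s, t] (EFin \o g) -> mu.-integrable `[a, b] (EFin \o L) ->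
  (forall r, a <= r -> r <= b -> 0 <= L r) ->
  (forall r, s <= r -> r <= t -> `|g r| <= L r) ->
  `|\int[mu]_(r in `[s, t]) g r| <= \int[mu]_(r in `[a, b]) L r.
Proof.
move=> as_ tb ig iL L0 gL.
have sub : `[s, t] `<=` `[a, b].
  by apply: subset_itv; rewrite bnd_simp.
have iLt : mu.-integrable `[s, t] (EFin \o L) by exact: integrableS iL.
apply: le_trans (le_normr_Rintegral _ ig) _ => //.
apply: (@le_trans _ _ (\int[mu]_(r in `[s, t]) L r)).
  apply: le_Rintegral => // [|r].
    exact: integrable_norm.
  by rewrite /= in_itv /= => /andP[]; exact: gL.
rewrite /Rintegral fine_le ?integrable_fin_num //.
apply: ge0_subset_integral => //.
  by case/integrableP : iL.
by move=> r; rewrite /= in_itv /= lee_fin => /andP[]; exact: L0.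
Qed.

(** Bounds [w] by its initial value and the L1 norms of the coordinates of [g]; this supplies finite
    suprema to the estimates below. *)
Lemma primitive_bounded k (a b : R) (w g : R -> 'cV[R]_k) :
  (forall t, a <= t -> t <= b -> forall i,
     mu.-integrable `[a, t] (fun r => (g r i 0)%:E) /\
     w t i 0 = w a i 0 + \int[mu]_(r in `[a, t]) g r i 0) ->
  exists M, forall t, a <= t -> t <= b -> `|w t| <= M.
Proof.
move=> wE; exists (`|w a| + \sum_i \int[mu]_(r in `[a, b]) `|g r i 0|) => t at_ tb.
have g0 i : 0 <= \int[mu]_(r in `[a, b]) `|g r i 0| by exact: Rintegral_ge0.
apply: cV_norm_le => [|i]; first by rewrite addr_ge0 // sumr_ge0.
have [ig ->] := wE t at_ tb i.
apply: le_trans (ler_normD _ _) _; rewrite lerD ?le_cV_norm // (bigD1 i) //=.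
rewrite ler_wpDr ?sumr_ge0 //; apply: normr_Rintegral_le => //.
have [ib _] := wE b (le_trans at_ tb) (lexx _) i.
exact: (integrable_norm ib).
Qed.

(** The integral of [L] being at most one half, the finite supremum [M] of [|w|] satisfies
    [M <= |w a| + M / 2]. *)
Lemma gronwall_short k (a b : R) (w g : R -> 'cV[R]_k) (L : R -> R) :
  (forall t, a <= t -> t <= b -> forall i,
     mu.-integrable `[a, t] (fun r => (g r i 0)%:E) /\
     w t i 0 = w a i 0 + \int[mu]_(r in `[a, t]) g r i 0) ->
  mu.-integrable `[a, b] (EFin \o L) ->
  (forall r, a <= r -> r <= b -> 0 <= L r) ->
  (forall r, a <= r -> r <= b -> `|g r| <= L r * `|w r|) ->
  \int[mu]_(r in `[a, b]) L r <= 2^-1 ->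
  forall t, a <= t -> t <= b -> `|w t| <= 2 * `|w a|.
Proof.
move=> wE iL L0 gL L2 t at_ tb.
have ab := le_trans at_ tb.
pose S := [set `|w r| | r in `[a, b]].
have itvE r : `[a, b]%classic r <-> a <= r /\ r <= b.
  by rewrite /= in_itv /=; split=> /andP.
have S0 : S !=set0 by exists `|w a|, a => //; apply/itvE.
have [M wM] := primitive_bounded wE.
have supS : has_sup S.
  by split=> //; exists M => _ [r /itvE[ar rb] <-]; exact: wM.
have leS r : a <= r -> r <= b -> `|w r| <= sup S.
  by move=> ar rb; apply: sup_upper_bound => //; exists r => //; apply/itvE.
have sup0 : 0 <= sup S by apply: le_trans (leS a _ _).
suff : sup S <= `|w a| + sup S / 2.
  by have := leS t at_ tb; lra.
apply: ge_sup => // _ [r /itvE[ar rb] <-].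
apply: cV_norm_le => [|i]; first by rewrite addr_ge0 // divr_ge0.
have [ig ->] := wE r ar rb i.
apply: le_trans (ler_normD _ _) _; rewrite lerD ?le_cV_norm //.
apply: (@le_trans _ _ (\int[mu]_(r in `[a, b]) (sup S * L r))).
  apply: normr_Rintegral_le => //.
  - by apply: eq_integrable (integrableZl _ (sup S) iL) => // r _.
  - by move=> s as_ sb; rewrite mulr_ge0 // L0.
  - move=> s as_ sr; have sb := le_trans sr rb.
    apply: le_trans (le_cV_norm _ _) _; apply: le_trans (gL _ as_ sb) _.
    by rewrite mulrC ler_wpM2r ?L0 // leS.
rewrite RintegralZl //.
by rewrite ler_wpM2l.
Qed.

End Short_intervals.

(** The Caratheodory condition with a free integrand [g], so that it also applies to the projection
    of a trajectory by a matrix. *)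
Definition indefinite_integral (R : realType) k (D : set R) (w g : R -> 'cV[R]_k) :=
  forall s t, D s -> D t -> s <= t -> forall i,
    lebesgue_measure.-integrable `[s, t] (fun r => (g r i 0)%:E) /\
    w t i 0 = w s i 0 + \int[lebesgue_measure]_(r in `[s, t]) g r i 0.

Section Gronwall.
Context {R : realType}.
Notation mu := (@lebesgue_measure R).

Lemma fine_lebesgue_itv (s t : R) : s <= t -> fine (mu `[s, t]) = t - s.
Proof.
move=> st; rewrite lebesgue_measure_itv /= lte_fin; case: ltP => // ts.
by rewrite (le_anti (introT andP (conj st ts))) subrr.
Qed.

Lemma integrable_itv_cst (s t c : R) : mu.-integrable `[s, t] (EFin \o cst c).
Proof.
apply: measurable_bounded_integrable => //.
  suff : (mu `[s, t] < +oo)%E by [].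
  by rewrite lebesgue_measure_itv /=; case: ifP => _; rewrite ?ltry.
by exists `|c|; split=> // x xc y _ /=; exact: ltW.
Qed.

Variables (D : set R) (v : R -> R).
Hypotheses (mD : measurable D) (mv : measurable_fun D v) (v0 : forall r, 0 <= v r)
  (iv2 : mu.-integrable D (fun r => (v r ^+ 2)%:E)).

(* Young: [v <= e + v^2 / e]. *)
Lemma L2_Rintegral_le (s t e : R) : s <= t -> `[s, t] `<=` D -> 0 < e ->
  mu.-integrable `[s, t] (EFin \o v) /\
  \int[mu]_(r in `[s, t]) v r <=
    e * (t - s) + e^-1 * \int[mu]_(r in `[s, t]) v r ^+ 2.
Proof.
move=> st stD e0.
have iv2' : mu.-integrable `[s, t] (fun r => (v r ^+ 2)%:E) by exact: integrableS iv2.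
have ibnd : mu.-integrable `[s, t] (EFin \o (fun r => e + e^-1 * v r ^+ 2)).
  apply: (@eq_integrable _ _ _ mu _ _ ((EFin \o cst e) \+
      (fun r => e^-1%:E * (v r ^+ 2)%:E))%E) => //.
  apply: integrableD => //; first exact: integrable_itv_cst.
  exact: integrableZl.
have vle r : v r <= e + e^-1 * v r ^+ 2.
  have [ve|ev] := leP (v r) e.
    by rewrite ler_wpDr // mulr_ge0 ?sqr_ge0 // invr_ge0 ltW.
  rewrite ler_wpDl ?(ltW e0) // mulrC expr2 -mulrA ler_peMr //.
  by rewrite ler_pdivlMr // mul1r ltW.
have iv : mu.-integrable `[s, t] (EFin \o v).
  apply: le_integrable ibnd => //.
    by apply/measurable_EFinP; exact: measurable_funS mv.
  move=> r _ /=; rewrite lee_fin !ger0_norm //.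
  by apply: le_trans (vle r).
split=> //.
rewrite -(fine_lebesgue_itv st).
apply: (@le_trans _ _ (\int[mu]_(r in `[s, t]) (e + e^-1 * v r ^+ 2))).
  by apply: le_Rintegral => // r _.
rewrite RintegralD // ?Rintegral_cst // ?RintegralZl //.
  exact: integrable_itv_cst.
by apply: eq_integrable (integrableZl _ e^-1 iv2').
Qed.

Hypothesis convD : forall s t, D s -> D t -> `[s, t] `<=` D.

(** The parameter [e] is a trade-off: a large [e] suits short intervals with arbitrary [U]
    ([gronwall_zero]), a small one suits a fixed length with tiny [U] ([stable_backward_zero]). *)
Lemma affine_L2_Rintegral_le (s t e al be U : R) : D s -> D t -> s <= t -> 0 < e ->
  0 <= be -> \int[mu]_(r in `[s, t]) v r ^+ 2 <= U ->
  mu.-integrable `[s, t] (EFin \o (fun r => al + be * v r)) /\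
  \int[mu]_(r in `[s, t]) (al + be * v r) <= al * (t - s) + be * (e * (t - s) + e^-1 * U).
Proof.
move=> Ds Dt st e0 be0 vU.
have [iv vle] := L2_Rintegral_le st (convD Ds Dt) e0.
have ibv : mu.-integrable `[s, t] (EFin \o (fun r => be * v r)).
  by apply: eq_integrable (integrableZl _ be iv) => // r _.
split.
  apply: (@eq_integrable _ _ _ mu _ _ ((EFin \o cst al) \+
      (EFin \o (fun r => be * v r)%R))%E) => //.
  by apply: integrableD => //; exact: integrable_itv_cst.
rewrite RintegralD // ?RintegralZl //; last exact: integrable_itv_cst.
rewrite Rintegral_cst // fine_lebesgue_itv // lerD2l ler_wpM2l // (le_trans vle) //.
by rewrite lerD2l ler_wpM2l // invr_ge0 ltW.
Qed.

(** [[a, b]] is covered by finitely many steps on which the rate [al + be * v r] integrates to at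
    most one half; on each of them [gronwall_short] propagates the value 0. *)
Lemma gronwall_zero k (al be : R) (w g : R -> 'cV[R]_k) a b :
  D a -> D b -> a <= b -> indefinite_integral D w g -> 0 <= al -> 0 <= be ->
  (forall r, a <= r -> r <= b -> `|g r| <= (al + be * v r) * `|w r|) ->
  w a = 0 -> w b = 0.
Proof.
move=> Da Db ab wE al0 be0 gle wa.
pose U := \int[mu]_(r in `[a, b]) v r ^+ 2.
have U0 : 0 <= U by apply: Rintegral_ge0 => r _; exact: sqr_ge0.
(* This makes [be * U / e] at most 1/4; the step length [d] below bounds the remaining part by 1/4
   as well. *)
pose e := 4 * be * U + 1.
have beU : 0 <= be * U by rewrite mulr_ge0.
have e0 : 0 < e by rewrite /e; lra.
pose K := al + be * e + 1.
have bee : 0 <= be * e by rewrite mulr_ge0 // ltW.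
have K0 : 0 < K by rewrite /K; lra.
pose d := (4 * K)^-1.
have d0 : 0 < d by rewrite invr_gt0; lra.
have Dab r : a <= r -> r <= b -> D r.
  by move=> ar rb; apply: (convD Da Db); rewrite /= in_itv /= ar.
have step s t : a <= s -> s <= t -> t <= b -> t <= s + d -> w s = 0 -> w t = 0.
  move=> as_ st tb tsd ws.
  have sb := le_trans st tb; have at_ := le_trans as_ st.
  have vU : \int[mu]_(r in `[s, t]) v r ^+ 2 <= U.
    have ? : mu.-integrable `[a, b] (EFin \o (fun r => v r ^+ 2)).
      by apply: integrableS iv2 => //; exact: convD.
    have ? : mu.-integrable `[s, t] (EFin \o (fun r => v r ^+ 2)).
      by apply: integrableS iv2 => //; apply: convD; exact: Dab.
    rewrite -[leLHS]ger0_norm; last by apply: Rintegral_ge0 => r _; exact: sqr_ge0.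
    by apply: normr_Rintegral_le => // r _ _; rewrite ?ger0_norm ?sqr_ge0.
  have [iL Lle] := affine_L2_Rintegral_le al (Dab _ as_ sb) (Dab _ at_ tb) st e0 be0 vU.
  apply/eqP; rewrite -normr_le0 -(mulr0 2) -(normr0 'cV[R]_k) -ws.
  apply: (gronwall_short _ iL) => //.
  - by move=> r sr rt i; apply: wE => //; apply: Dab => //; lra.
  - by move=> r _ _; rewrite addr_ge0 // mulr_ge0.
  - by move=> r sr rt; apply: gle; lra.
  apply: le_trans Lle _.
  have -> : al * (t - s) + be * (e * (t - s) + e^-1 * U) =
     (t - s) * (al + be * e) + be * U / e by ring.
  have : be * U / e <= 4^-1 by rewrite ler_pdivrMr // /e; lra.
  have : (t - s) * (al + be * e) <= d * K.
    by apply: ler_pM; rewrite ?subr_ge0 ?addr_ge0 // /K; lra.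
  have -> : d * K = 4^-1 by rewrite /d; field; rewrite gt_eqF.
  by lra.
have all j : forall t, a <= t -> t <= b -> t <= a + j%:R * d -> w t = 0.
  elim: j => [|j IH] t at_ tb tj.
    suff -> : t = a by []; lra.
  (* One step back, cut off at [a], falls within reach of the induction hypothesis. *)
  apply: (step (Num.max a (t - d))) => //.
  - by rewrite le_max lexx.
  - by rewrite ge_max at_ /= gerBl ltW.
  - by rewrite -lerBlDr le_max lexx orbT.
  apply: IH; rewrite ?le_max ?ge_max ?lexx ?ab //=.
    by lra.
  rewrite lerDl mulr_ge0 ?(ltW d0) //=.
  by move: tj; rewrite -natr1 mulrDl mul1r; lra.
have [j bj] : exists j : nat, (b - a) / d <= j%:R.
  exists (Num.bound ((b - a) / d)); apply/ltW/archi_boundP.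
  by rewrite divr_ge0 ?subr_ge0 ?(ltW d0).
by apply: (all j) => //; rewrite -lerBlDl -ler_pdivrMr.
Qed.

End Gronwall.

(** * Vanishing near minus infinity under a stable linear part *)

Section Backward.
Context {R : realType}.
Notation mu := (@lebesgue_measure R).
Variable v : R -> R.
Hypotheses (mv : measurable_fun `]-oo, (0 : R)] v) (v0 : forall r, 0 <= v r)
  (iv2 : mu.-integrable `]-oo, (0 : R)] (fun r => (v r ^+ 2)%:E)).

(** The integrals over [[- n, 0]] converge to the finite integral over the half-line, so the mass to
    the left of some [- n] is at most [e]. *)
Lemma L2_tail e : 0 < e -> exists2 T, T <= 0 &
  forall s t, s <= t -> t <= T -> \int[mu]_(r in `[s, t]) v r ^+ 2 <= e.
Proof.
move=> e0; pose D : set R := `]-oo, 0]%classic.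
pose f r := (v r ^+ 2)%:E; pose F n : set R := `[- n%:R, 0 : R]%classic.
have FD n : F n `<=` D.
  by move=> r; rewrite /F /D /= !in_itv /= => /andP[].
have cvgF : (\int[mu]_(r in F n) f r @[n --> \oo] --> \int[mu]_(r in D) f r)%E.
  have -> : D = \bigcup_n F n.
    apply/seteqP; split=> [r|r [n _ /FD//]].
    rewrite /D /= in_itv /= => r0; exists (Num.bound (- r)) => //.
    rewrite /F /= in_itv /= r0 andbT lerNl; apply/ltW/archi_boundP.
    by rewrite oppr_ge0.
  apply: ge0_nondecreasing_set_cvg_integral => //.
  - apply/nondecreasing_seqP => n; rewrite subsetEset.
    by apply: subset_itv => //; rewrite bnd_simp lerN2 ler_nat.
  - by move=> n; exact: measurable_itv.
  - move=> n; apply: measurable_funS (FD n) (measurable_int mu iv2).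
    exact: measurable_itv.
  - by move=> n r _; rewrite lee_fin sqr_ge0.
have cvgR : \int[mu]_(r in F n) v r ^+ 2 @[n --> \oo] -->
    \int[mu]_(r in D) v r ^+ 2.
  have fD : (\int[mu]_(r in D) f r = (\int[mu]_(r in D) v r ^+ 2)%R%:E)%E.
    by rewrite fineK //; apply: integrable_fin_num iv2; exact: measurable_itv.
  by move: cvgF; rewrite fD => /fine_cvg; exact.
have := cvgR => /cvgrPdist_le/(_ _ e0)[n _ /(_ _ (leqnn n))] /= nle.
(* The extra 1 makes [[s, t]] disjoint from [F n], so that their integrals add up. *)
exists (- n%:R - 1) => [|s t st tn]; first by rewrite -opprD oppr_le0 addr_ge0.
pose I J := \int[mu]_(r in J) v r ^+ 2.
have tD : `[s, t] `<=` D.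
  move=> r; rewrite /D /= !in_itv /= => /andP[_ rt].
  by have := ler0n R n; lra.
have disj : [disjoint `[s, t]%classic & F n].
  apply/disj_setPS => r []; rewrite /F /= !in_itv /= => /andP[_ rt] /andP[nr _].
  by exfalso; lra.
have iU : mu.-integrable (`[s, t] `|` F n) (EFin \o (fun r => v r ^+ 2)).
  apply: integrableS iv2 => [||r [/tD|/FD] //]; first exact: measurable_itv.
  by apply: measurableU; exact: measurable_itv.
have UE : I (`[s, t]%classic `|` F n) = I `[s, t]%classic + I (F n).
  by apply: Rintegral_setU => //; exact: measurable_itv.
have : I (`[s, t]%classic `|` F n) <= I D.
  rewrite /I /Rintegral fine_le //.
  - by apply: integrable_fin_num iU; apply: measurableU; exact: measurable_itv.
  - by apply: integrable_fin_num iv2; exact: measurable_itv.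
  apply: ge0_subset_integral.
  - by apply: measurableU; exact: measurable_itv.
  - exact: measurable_itv.
  - exact: measurable_int iv2.
  - by move=> r _; rewrite lee_fin sqr_ge0.
  - by move=> r [/tD|/FD].
rewrite UE /I -lerBrDr => /le_trans; apply.
exact: le_trans (ler_norm _) nle.
Qed.

(** Over one step the Euler map gains [h * c * N (w t)], which pays for the drift of [w] inside the
    step and for the perturbation. Thus [N (w t)] is bounded by values of [N] along [w] arbitrarily
    far in the past, which tend to 0. *)
Lemma stable_backward_zero k (A : 'M[R]_k) (w g : R -> 'cV[R]_k) (x : R -> R) ga :
  stable_mx A -> 0 <= ga -> indefinite_integral `]-oo, 0] w g ->
  (forall r, 0 <= x r) ->
  (forall r, r <= 0 -> `|g r - A *m w r| <= ga * (x r + v r) * `|w r|) ->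
  (forall e, 0 < e -> exists2 T, T <= 0 & forall t, t <= T -> x t <= e) ->
  (forall e, 0 < e -> exists2 T, T <= 0 & forall t, t <= T -> `|w t| <= e) ->
  exists2 T, T <= 0 & forall t, t <= T -> w t = 0.
Proof.
move=> stA ga0 wE x0 gle xcvg wcvg.
have [N [c [h0 [K [[c0 h00 K0] [Npos ND Nlow Nup Nstep]]]]]] :=
  stable_contraction_norm stA.
have [al al0 Ale] := mulmx_norm_bound A.
have normN u : `|u| <= N u by apply: cV_norm_le => // i; exact: Nlow.
have Nnorm u : N u <= K * `|u| by apply: Nup => i; exact: le_cV_norm.
(* The three bounds give in turn the contraction of the Euler step, [h * al <= 1/4], and a
   second-order error [2 K (h al)^2] of at most half the gain [h c]. *)
pose h := Num.min h0 (Num.min (4 * (al + 1))^-1 (c / (4 * K * al ^+ 2 + 1))).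
have al20 : 0 <= 4 * K * al ^+ 2 by rewrite !mulr_ge0 // sqr_ge0.
have hpos : 0 < h.
  by rewrite !lt_min h00 invr_gt0 divr_gt0 //=; [lra|rewrite /=; lra].
have hh0 : h <= h0 by rewrite ge_min lexx.
have hal : h * al <= 4^-1.
  have : h <= (4 * (al + 1))^-1 by rewrite !ge_min lexx orbT.
  rewrite -[(4 * _)^-1]mul1r ler_pdivlMr; last lra.
  by lra.
have hc : h * (4 * K * al ^+ 2) <= c.
  have : h <= c / (4 * K * al ^+ 2 + 1) by rewrite !ge_min lexx !orbT.
  rewrite ler_pdivlMr; last lra.
  by lra.
(* The perturbation costs at most [5/2 K b], which is the other half of the gain; [b <= 1/4] keeps
   [h * al + b] below 1/2 for [gronwall_short]. *)
pose b := Num.min 4^-1 (h * c / (5 * K + 1)).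
have hc0 : 0 < h * c by rewrite mulr_gt0.
have b0 : 0 < b by rewrite lt_min invr_gt0 divr_gt0 //; lra.
have b4 : b <= 4^-1 by rewrite ge_min lexx.
have bK : b * (5 * K) <= h * c.
  have : b <= h * c / (5 * K + 1) by rewrite ge_min lexx orbT.
  rewrite ler_pdivlMr; last lra.
  by lra.
(* Near [-oo] the perturbation integrates to at most [b] over a step [h]. *)
pose m := b / (4 * (ga * h + 1)).
have gah : 0 <= ga * h by rewrite mulr_ge0 // ltW.
have m0 : 0 < m by rewrite divr_gt0 //; lra.
have mb : ga * h * m <= b / 4.
  have : m * (4 * (ga * h + 1)) = b by rewrite /m divfK // gt_eqF //; lra.
  by lra.
(* The L2 mass allowed over a step; the Young parameter is taken to be [m], so that [ga * U / m] is
   at most [b / 4]. *)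
pose U := m * (b / (4 * (ga + 1))).
have U0 : 0 < U by rewrite mulr_gt0 // divr_gt0 //; lra.
have Ub : ga * (m^-1 * U) <= b / 4.
  rewrite mulKf ?gt_eqF //; set q := b / (4 * (ga + 1)).
  have : q * (4 * (ga + 1)) = b by rewrite /q divfK // gt_eqF //; lra.
  have : 0 < q by rewrite divr_gt0 //; lra.
  by lra.
clearbody U m b h.
have [T1 T10 xT] := xcvg _ m0.
have [T2 T20 vT] := L2_tail U0.
pose T := Num.min T1 T2.
have T0 : T <= 0 by rewrite ge_min T10.
have Ddown (r : R) : r <= 0 -> `]-oo, (0 : R)]%classic r by rewrite /= in_itv.
have convD s t : `]-oo, (0 : R)]%classic s -> `]-oo, (0 : R)]%classic t ->
    `[s, t] `<=` `]-oo, (0 : R)].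
  rewrite /= !in_itv /= => s0 t0 r; rewrite /= !in_itv /= => /andP[_ rt].
  exact: le_trans rt t0.
have step t : t + h <= T -> N (w (t + h)) <= N (w t).
  move=> thT; have tth : t <= t + h by rewrite lerDl ltW.
  have th0 := le_trans thT T0.
  have Dt : `]-oo, (0 : R)]%classic t by apply: Ddown; exact: le_trans th0.
  have Dth := Ddown _ th0.
  have vU : \int[mu]_(r in `[t, t + h]) v r ^+ 2 <= U.
    by apply: vT => //; apply: le_trans thT _; rewrite ge_min lexx orbT.
  have thh : t + h - t = h by rewrite addrAC subrr add0r.
  have [iL Lle] := affine_L2_Rintegral_le (measurable_itv _) mv v0 iv2 convD
    (al + ga * m) Dt Dth tth m0 ga0 vU.
  have pert : ga * m * h + ga * (m * h + m^-1 * U) <= b.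
    by rewrite mulrDr; lra.
  have {}Lle : \int[mu]_(r in `[t, t + h]) (al + ga * m + ga * v r) <= h * al + b.
    by apply: le_trans Lle _; rewrite thh; lra.
  have L0 r : t <= r -> r <= t + h -> 0 <= al + ga * m + ga * v r.
    by move=> _ _; rewrite !addr_ge0 // mulr_ge0 // ltW.
  have gA r : t <= r -> r <= t + h -> `|g r - A *m w r| <= (ga * m + ga * v r) * `|w r|.
    move=> tr rth; apply: le_trans (gle _ (le_trans rth th0)) _.
    rewrite ler_wpM2r // -mulrDr ler_wpM2l // lerD2r xT //.
    by apply: le_trans rth (le_trans thT _); rewrite ge_min lexx.
  have gL r : t <= r -> r <= t + h -> `|g r| <= (al + ga * m + ga * v r) * `|w r|.
    move=> tr rth; rewrite -(subrK (A *m w r) (g r)) -(addrA al) mulrDl [leRHS]addrC.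
    by apply: le_trans (ler_normD _ _) _; rewrite lerD // gA.
  have w2 r : t <= r -> r <= t + h -> `|w r| <= 2 * `|w t|.
    apply: (gronwall_short _ iL L0 gL) => //; last by apply: le_trans Lle _; lra.
    by move=> s ts sth i; apply: wE => //; apply: Ddown; exact: le_trans sth _.
  have wt q : t <= q -> q <= t + h -> `|w q - w t| <= 2 * `|w t| * (h * al + b).
    move=> tr rth; apply: cV_norm_le => [|i].
      by rewrite !mulr_ge0 // addr_ge0 ?mulr_ge0 // ltW.
    have [|ig wq] := wE t q Dt _ tr i; first exact/Ddown/(le_trans rth).
    rewrite !mxE wq [X in `|X|]addrAC subrr add0r.
    apply: (@le_trans _ _ (\int[mu]_(r in `[t, t + h])
      (2 * `|w t| * (al + ga * m + ga * v r)))).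
      apply: normr_Rintegral_le => //.
      - by apply: eq_integrable (integrableZl _ (2 * `|w t|) iL) => // s _.
      - by move=> s ts sth; rewrite mulr_ge0 ?L0 // mulr_ge0.
      - move=> s ts sr; have sth := le_trans sr rth.
        apply: le_trans (le_cV_norm _ _) _; apply: le_trans (gL _ ts sth) _.
        by rewrite mulrC ler_wpM2r ?L0 // w2.
    by rewrite RintegralZl // ler_wpM2l // mulr_ge0.
  (* The error of the Euler step is the integral of [g r - A *m w t], split below into
     [A *m (w r - w t)], controlled by [wt], and the perturbation [g r - A *m w r]. *)
  pose ev := w (t + h) - (w t + h *: (A *m w t)).
  have evle : `|ev| <= 2 * `|w t| * (h * al * (h * al + b) + b).
    have hb0 : 0 <= h * al + b by rewrite addr_ge0 ?mulr_ge0 // ltW.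
    have wt0 : 0 <= 2 * `|w t| by rewrite mulr_ge0.
    have [iL' Lle'] := affine_L2_Rintegral_le (measurable_itv _) mv v0 iv2 convD
      (al * (h * al + b) + ga * m) Dt Dth tth m0 ga0 vU.
    apply: cV_norm_le => [|i].
      by rewrite mulr_ge0 // addr_ge0 ?mulr_ge0 // ltW.
    have [ig wi] := wE t (t + h) Dt Dth tth i.
    have -> : ev i 0 = \int[mu]_(r in `[t, t + h]) (g r i 0 - (A *m w t) i 0).
      rewrite RintegralB //; last exact: integrable_itv_cst.
      have -> : ev i 0 = w (t + h) i 0 - (w t i 0 + h * (A *m w t) i 0) by rewrite !mxE.
      by rewrite Rintegral_cst // fine_lebesgue_itv // thh wi; ring.
    apply: (@le_trans _ _ (\int[mu]_(r in `[t, t + h])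
      (2 * `|w t| * (al * (h * al + b) + ga * m + ga * v r)))).
      apply: normr_Rintegral_le => //.
      - apply: (@eq_integrable _ _ _ mu _ _ ((EFin \o (fun r => g r i 0)%R) \-
          (EFin \o cst ((A *m w t) i 0)%R))%E) => //.
        by apply: integrableB => //; exact: integrable_itv_cst.
      - by apply: eq_integrable (integrableZl _ (2 * `|w t|) iL') => // s _.
      - move=> s _ _; rewrite (mulr_ge0 wt0) // !addr_ge0 //.
        + exact: mulr_ge0.
        + exact: mulr_ge0 ga0 (ltW m0).
        + exact: mulr_ge0.
      - move=> s ts sth.
        have -> : g s i 0 - (A *m w t) i 0 =
            ((A *m (w s - w t)) + (g s - A *m w s)) i 0.
          have -> : A *m (w s - w t) + (g s - A *m w s) = g s - A *m w t.
            by rewrite mulmxBr addrC addrA subrK.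
          by rewrite [RHS]mxE [X in _ = _ + X]mxE.
        apply: le_trans (le_cV_norm _ _) _; apply: le_trans (ler_normD _ _) _.
        rewrite -addrA mulrDr; apply: lerD.
          apply: le_trans (Ale _) _; rewrite [leRHS]mulrCA ler_wpM2l //.
          exact: wt.
        apply: le_trans (gA _ ts sth) _; rewrite [leRHS]mulrC ler_wpM2l ?w2 //.
        by rewrite addr_ge0 // mulr_ge0 // ltW.
    rewrite RintegralZl // ler_wpM2l //; apply: le_trans Lle' _; rewrite thh.
    by move: pert; lra.
  have wE' : w (t + h) = (w t + h *: (A *m w t)) + ev by rewrite [RHS]addrC subrK.
  rewrite wE'; apply: le_trans (ND _ _) _.
  have evN : N ev <= K * (2 * N (w t) * ((h * al) ^+ 2 + 5 / 4 * b)).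
    apply: le_trans (Nnorm _) _; rewrite ler_wpM2l // (le_trans evle) //.
    have hal0 : 0 <= h * al by rewrite mulr_ge0 // ltW.
    have hb0 : 0 <= h * al + b by rewrite addr_ge0 // ltW.
    apply: ler_pM; [exact: mulr_ge0| |by rewrite ler_pM2l|].
      by rewrite addr_ge0 ?(ltW b0) // mulr_ge0.
    have : h * al * b <= 4^-1 * b by rewrite ler_wpM2r // ltW.
    by rewrite expr2 mulrDr; lra.
  have e1 : h * (h * (4 * K * al ^+ 2)) * N (w t) <= h * c * N (w t).
    by rewrite ler_wpM2r // ler_wpM2l // ltW.
  have e2 : b * (5 * K) * N (w t) <= h * c * N (w t) by rewrite ler_wpM2r.
  by have := Nstep h (w t) hpos hh0; rewrite exprMn in evN; lra.
have Nback j t : t <= T -> N (w t) <= N (w (t - j%:R * h)).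
  move=> tT; elim: j => [|j IH]; first by rewrite mul0r subr0.
  apply: le_trans IH _; have -> : t - j%:R * h = t - j.+1%:R * h + h.
    by rewrite -natr1; ring.
  apply: step; have -> : t - j.+1%:R * h + h = t - j%:R * h by rewrite -natr1; ring.
  by apply: le_trans tT; rewrite gerBl mulr_ge0 // ltW.
exists T => // t tT; apply/eqP; rewrite -normr_le0.
apply/ler_addgt0Pl => e e0; rewrite addr0.
(* [N] is at most [K] times the maximum norm; [K + 1] avoids a division by 0. *)
have [|S S0 wS] := wcvg (e / (K + 1)); first by rewrite divr_gt0 //; lra.
have [j jh] : exists j : nat, t - j%:R * h <= S.
  exists (Num.bound (`|t - S| / h)).
  have : `|t - S| / h < (Num.bound (`|t - S| / h))%:R.
    by apply: archi_boundP; rewrite divr_ge0 // ltW.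
  rewrite ltr_pdivrMr //; have := ler_norm (t - S).
  by lra.
apply: le_trans (normN _) _; apply: le_trans (Nback j _ tT) _.
apply: le_trans (Nnorm _) _.
apply: (@le_trans _ _ (K * (e / (K + 1)))); first by rewrite ler_wpM2l // wS.
by rewrite mulrCA ler_piMr ?(ltW e0) // ler_pdivrMr; lra.
Qed.

End Backward.

(** * Trajectories of quadratic-bilinear systems *)

Section Inputs.
Context {R : realType}.
Notation mu := (@lebesgue_measure R).

Lemma enorm_ge0 n (u : 'cV[R]_n) : 0 <= enorm u.
Proof. exact: sqrtr_ge0. Qed.

Lemma coord_le_enorm n (u : 'cV[R]_n) i : `|u i 0| <= enorm u.
Proof.
rewrite -sqrtr_sqr ler_wsqrtr // (bigD1 i) //= lerDl sumr_ge0 // => j _.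
exact: sqr_ge0.
Qed.

Lemma enorm0 n : enorm (0 : 'cV[R]_n) = 0.
Proof.
by rewrite /enorm big1 ?sqrtr0 // => i _; rewrite mxE expr0n.
Qed.

Lemma in_L2_enorm m (D : set R) (u : R -> 'cV[R]_m) :
  measurable D -> in_L2 D u ->
  measurable_fun D (fun t => enorm (u t)) /\
  mu.-integrable D (fun t => (enorm (u t) ^+ 2)%:E).
Proof.
move=> mD [mu_ Lu].
have me : measurable_fun D (fun t => enorm (u t)).
  apply: (measurableT_comp (continuous_measurable_fun (@sqrt_continuous R))).
  by apply: measurable_sum => i; exact: measurable_funX.
split=> //; apply/integrableP; split.
  by apply/measurable_EFinP; exact: measurable_funX.
have : (input_norm 2%:E D u `^ 2 < +oo)%E by exact: poweR_lty.
rewrite /input_norm powR_Lnorm ?pnatr_eq0 //.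
congr (_ < _)%E; rewrite [RHS]integral_mkcond; apply: eq_integral => t _.
rewrite !patchE; case: ifP => _; last by rewrite abse0 poweR0r ?pnatr_eq0.
by rewrite /= powR_mulrn ?normr_ge0 // ger0_norm ?enorm_ge0 // ger0_norm ?sqr_ge0.
Qed.

End Inputs.

Section Projection.
Context {R : realType} {n m p : nat} (sys : qb_system R n m p).
Let A := qbA sys.
Let H := qbH sys.
Let N := qbN sys.

(** Keeping [a + b] whole in the last product leaves just two terms containing [b], each linear in
    its explicit factor [b]. *)
Lemma tens_split (a b : 'cV[R]_n) :
  (a + b) *t (a + b) = a *t a + a *t b + b *t (a + b) :> 'cV_(n * n).
Proof.
apply/matrixP => i j; case: (mxtens_indexP i) => i1 i2; rewrite ord1.
rewrite tens_colE [RHS]mxE [X in _ = X + _]mxE !tens_colE !mxE.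
by ring.
Qed.

(** Ker [E] is invariant under the homogeneous field for every value of the input. *)
Definition invariant_kernel k (E : 'M[R]_(k, n)) : Prop :=
  forall z : 'cV_n, E *m z = 0 ->
  [/\ E *m (A *m z) = 0, E *m (H *m (z *t z)) = 0 &
      forall l, E *m (N l *m z) = 0].

(* Split [x = a + b] with [E a = 0] and [`|b|] at most a multiple of [`|E x|]:
   only the terms containing [b] survive in [E f]. *)
Lemma projected_field_bound k (E : 'M[R]_(k, n)) :
  invariant_kernel E ->
  exists2 ga, 0 <= ga & forall x u,
    `|E *m qb_field_hom sys x u - conjmx E A *m (E *m x)| <=
      ga * (`|x| + enorm u) * `|E *m x|.
Proof.
move=> kerE.
have [F -> EFE] : exists2 F, conjmx E A = E *m A *m F & E *m F *m E = E.
  by exists (pinvmx E); rewrite ?mulmxKpV.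
have [KF KF0 Fle] := mulmx_norm_bound F.
have [KE KE0 Ele] := mulmx_norm_bound E.
have [KH KH0 Hle] := mulmx_norm_bound (E *m H).
have /choice[KN KNle] : forall l, exists K,
    0 <= K /\ forall v : 'cV_n, `|E *m N l *m v| <= K * `|v|.
  by move=> l; have [K] := mulmx_norm_bound (E *m N l); exists K.
have SN0 : 0 <= \sum_l KN l by apply: sumr_ge0 => l _; have [] := KNle l.
exists (KH * (1 + KF * KE) * KF + KH * KF + (\sum_l KN l) * KF) => [|x u].
  by rewrite !addr_ge0 ?mulr_ge0 ?addr_ge0 ?mulr_ge0.
set w := E *m x; pose b := F *m w; pose a := x - b.
have Ea : E *m a = 0 by rewrite mulmxBr /b /w !mulmxA EFE subrr.
have [EAa EHa ENa] := kerE a Ea.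
have xE : x = a + b by rewrite subrK.
have bw : `|b| <= KF * `|w| by exact: Fle.
have wx : `|w| <= KE * `|x| by exact: Ele.
have bx : `|b| <= KF * KE * `|x|.
  by apply: le_trans bw _; rewrite -mulrA ler_wpM2l.
have ax : `|a| <= (1 + KF * KE) * `|x|.
  by apply: le_trans (ler_normB _ _) _; rewrite mulrDl mul1r lerD2l.
have EAx : E *m (A *m x) = E *m A *m F *m w.
  by rewrite {1}xE mulmxDr mulmxDr EAa add0r /b !mulmxA.
have EHx : E *m (H *m (x *t x)) = E *m H *m (a *t b) + E *m H *m (b *t x).
  by rewrite {1 2}xE tens_split -xE !mulmxDr EHa add0r !mulmxA.
have ENx l : E *m (N l *m x) = E *m N l *m b.
  by rewrite {1}xE mulmxDr mulmxDr ENa add0r mulmxA.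
rewrite /qb_field_hom -/A -/H -/N !mulmxDr EAx EHx.
(* The linear term cancels exactly: [E *m (A *m x)] is the induced matrix applied to [w]. *)
rewrite -addrA addrC addrA addrNK mulmx_sumr.
have hN : `|\sum_l E *m (u l 0 *: (N l *m x))| <=
    (\sum_l KN l) * (enorm u * (KF * `|w|)).
  apply: le_trans (ler_norm_sum _ _ _) _; rewrite mulr_suml; apply: ler_sum => l _.
  have [KN0 KNb] := KNle l.
  rewrite -scalemxAr ENx normrZ mulrCA ler_pM ?coord_le_enorm //.
  by apply: le_trans (KNb b) _; rewrite ler_wpM2l.
have h1 : `|E *m H *m (a *t b)| <= KH * ((1 + KF * KE) * `|x| * (KF * `|w|)).
  apply: le_trans (Hle _) _.
  by rewrite ler_wpM2l // (le_trans (tens_norm_le _ _)) // ler_pM.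
have h2 : `|E *m H *m (b *t x)| <= KH * (KF * `|w| * `|x|).
  apply: le_trans (Hle _) _.
  by rewrite ler_wpM2l // (le_trans (tens_norm_le _ _)) // ler_pM.
apply: le_trans (ler_normD _ _) _; apply: le_trans (lerD hN (ler_normD _ _)) _.
apply: le_trans (lerD (lexx _) (lerD h1 h2)) _.
have e0 := enorm_ge0 u.
have c1 : 0 <= KH * (1 + KF * KE) * KF * enorm u * `|w|.
  by rewrite !mulr_ge0 // addr_ge0 // mulr_ge0.
have c2 : 0 <= KH * KF * enorm u * `|w| by rewrite !mulr_ge0.
have c3 : 0 <= (\sum_l KN l) * KF * `|x| * `|w| by rewrite !mulr_ge0.
by lra.
Qed.

End Projection.

Lemma trajectory_mulmx (R : realType) n m k (E : 'M[R]_(k, n))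
    (f : 'cV[R]_n -> 'cV[R]_m -> 'cV[R]_n) (D : set R) u x :
  is_trajectory f D u x ->
  indefinite_integral D (fun t => E *m x t) (fun t => E *m f (x t) (u t)).
Proof.
move=> fx s t Ds Dt st i.
have intf j := (fx s t Ds Dt st j).1.
have fE : (fun r => (E *m f (x r) (u r)) i 0) =
    (fun r => \sum_j E i j * f (x r) (u r) j 0).
  by apply/funext => r; rewrite mxE.
split.
  have -> : (fun r => ((E *m f (x r) (u r)) i 0)%:E) =
      (fun r => (\sum_j E i j * f (x r) (u r) j 0)%:E).
    by apply/funext => r; rewrite mxE.
  exact: integrable_lincomb.
rewrite fE Rintegral_lincomb // !mxE -big_split /=.
by apply: eq_bigr => j _; rewrite -mulrDr -(fx s t Ds Dt st j).2.
Qed.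

(** [eigenvalue] refers to row vectors: multiplying an eigenvector of the induced matrix by [E]
    gives one of [A] for the same eigenvalue, nonzero since [E] has full row rank. *)
Lemma stable_conjmx (R : realType) n k (A : 'M[R]_n) (E : 'M[R]_(k, n)) :
  row_free E -> stablemx E A -> stable_mx A -> stable_mx (conjmx E A).
Proof.
move=> freeE EA stA z; rewrite /conjmx 2!map_mxM map_pinvmx => ez.
apply/stA/(@eigenvalue_conjmx _ _ _ (map_mx (real_complex R) E)).
- by rewrite -map_mxM map_submx.
- by rewrite row_free_map.
- exact: ez.
Qed.

(** The image of [P] is cut out by its cokernel, whose transpose lies in the left kernel when [P] is
    symmetric. *)
Lemma symmx_ker_im (R : fieldType) n (P : 'M[R]_n) (z : 'cV[R]_n) :
  P^T = P -> kermx P *m z = 0 -> exists y : 'cV[R]_n, z = P *m y.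
Proof.
move=> symP Pz; suff /submxP[y zy] : (z^T <= P)%MS.
  by exists y^T; rewrite -[z]trmxK zy trmx_mul symP.
rewrite submxE; apply/eqP.
have : ((cokermx P)^T <= kermx P)%MS.
  by apply/sub_kermxP; rewrite -{2}symP -trmx_mul mulmx_coker trmx0.
move=> /submxP[y yP]; apply: trmx_inj.
by rewrite trmx_mul trmxK yP -mulmxA Pz mulmx0 trmx0.
Qed.

(** * Reachable states and the image of P *)

Section Reachability.
Context {R : realType} {n m p : nat} (sys : qb_system R n m p).

(** On [[a, b]] the trajectory is bounded by some [M], so [E x] obeys a linear bound with rate
    [al + ga * M + ga * |u|]. The field [f] is only compared after projection, which covers both the
    full and the homogeneous system. *)
Lemma invariant_kernel_trajectory k (E : 'M[R]_(k, n)) f (D : set R) u x a b :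
  measurable D -> (forall s t, D s -> D t -> `[s, t] `<=` D) ->
  (forall y w, E *m f y w = E *m qb_field_hom sys y w) ->
  invariant_kernel sys E -> in_L2 D u -> is_trajectory f D u x ->
  D a -> D b -> a <= b -> E *m x a = 0 -> E *m x b = 0.
Proof.
move=> mD convD fE inv L2u trx Da Db ab xa.
have [ga ga0 gle] := projected_field_bound inv.
have [al al0 Ale] := mulmx_norm_bound (conjmx E (qbA sys)).
have [mv iv2] := in_L2_enorm mD L2u.
have Dab r : a <= r -> r <= b -> D r.
  by move=> ar rb; apply: (convD _ _ Da Db); rewrite /= in_itv /= ar.
have [M xM] : exists M, forall t, a <= t -> t <= b -> `|x t| <= M.
  apply: (@primitive_bounded _ _ _ _ _ (fun r => f (x r) (u r))) => t at_ tb.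
  by apply: trx => //; exact: Dab.
have M0 : 0 <= M by apply: le_trans (xM a _ _).
apply: (gronwall_zero mD mv (fun=> enorm_ge0 _) iv2 convD Da Db ab
    (trajectory_mulmx E trx) _ ga0 _ xa (al := al + ga * M)).
  by rewrite addr_ge0 // mulr_ge0.
move=> r ar rb; rewrite fE.
set d := E *m qb_field_hom _ _ _; rewrite -(subrK (conjmx E (qbA sys) *m (E *m x r)) d).
apply: le_trans (ler_normD _ _) _; apply: le_trans (lerD (gle _ _) (Ale _)) _.
rewrite -mulrDl ler_wpM2r // addrC -addrA lerD2l -mulrDr ler_wpM2l // lerD2r.
exact: xM.
Qed.

Lemma steered_state_in_image (P : 'M[R]_n) (x0 : 'cV[R]_n) u :
  stable_mx (qbA sys) -> psd_mx P -> reachability_equation sys P ->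
  steers_to sys x0 u -> exists z : 'cV[R]_n, x0 = P *m z.
Proof.
move=> stA psdP eqP [L2u [x [trx xcvg <-]]].
have [symP _] := psdP.
(* The rows of [E] form a basis of the left kernel of [P], so that Ker [E] is Im [P]; independence
   of the rows is what [stable_conjmx] requires. *)
pose E := row_base (kermx P).
have EP : E *m P = 0 by apply/sub_kermxP; rewrite eq_row_base.
have freeE : row_free E by exact: row_base_free.
have [EAP EHP ENP EB] := gramian_equation_ker psdP psdP eqP EP.
have kerIm (z : 'cV_n) : E *m z = 0 -> exists y : 'cV_n, z = P *m y.
  move=> Ez; apply: symmx_ker_im => //.
  have /submxP[D ->] : (kermx P <= E)%MS by rewrite eq_row_base.
  by rewrite -mulmxA Ez mulmx0.
have inv : invariant_kernel sys E.
  move=> z /kerIm[y ->]; split=> [||l].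
  - by rewrite !mulmxA EAP mul0mx.
  - by rewrite -tensmx_mul !mulmxA EHP mul0mx.
  - by rewrite !mulmxA ENP mul0mx.
have [ga ga0 gle] := projected_field_bound inv.
(* [E *m A *m P = 0] places the rows of [E *m A] in the left kernel of [P], which is the row space
   of [E]. *)
have stabE : stablemx E (qbA sys).
  by apply: (@submx_trans _ _ _ _ _ _ (kermx P)); [exact/sub_kermxP|rewrite eq_row_base].
apply: kerIm.
have [mv iv2] := in_L2_enorm (measurable_itv _) L2u.
pose g r := E *m qb_field_hom sys (x r) (u r).
have fE y v : E *m qb_field sys y v = E *m qb_field_hom sys y v.
  by rewrite /qb_field mulmxDr mulmxA EB mul0mx addr0.
have wE : indefinite_integral `]-oo, 0] (fun t => E *m x t) g.
  have -> : g = fun r => E *m qb_field sys (x r) (u r).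
    by apply/funext => r; rewrite fE.
  exact: trajectory_mulmx trx.
have [KE KE0 Ele] := mulmx_norm_bound E.
have xT e : 0 < e -> exists2 T, T <= 0 & forall t, t <= T -> `|x t| <= e.
  move=> e0; have [M [_ Mx]] := cvgr0_norm_le _ xcvg e e0.
  (* The limit at [-oo] speaks of times strictly below [M], hence [M - 1]. *)
  exists (Num.min 0 (M - 1)) => [|t]; first by rewrite ge_min lexx.
  by rewrite le_min => /andP[_ tM]; apply: Mx; lra.
have [|T T0 wT] := stable_backward_zero mv (fun=> enorm_ge0 _) iv2
    (stable_conjmx freeE stabE stA) ga0 wE (fun r => normr_ge0 (x r))
    (fun r _ => gle _ _) xT.
  move=> e e0; have [|T T0 Tx] := xT (e / (KE + 1)).
    by rewrite divr_gt0 // ltr_wpDl.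
  exists T => // t /Tx tx; apply: le_trans (Ele _) _.
  apply: (@le_trans _ _ (KE * (e / (KE + 1)))); first by rewrite ler_wpM2l.
  by rewrite mulrCA ler_piMr ?(ltW e0) // ler_pdivrMr; lra.
apply: (invariant_kernel_trajectory _ _ fE inv L2u trx _ _ T0 (wT _ (lexx _))).
- exact: measurable_itv.
- move=> s t; rewrite /= !in_itv /= => _ t0 r; rewrite /= !in_itv /= => /andP[_ rt].
  exact: le_trans rt t0.
- by rewrite /= in_itv.
- by rewrite /= in_itv /= lexx.
Qed.

End Reachability.

(** * Unobservable states and the kernel of Q *)

Lemma sum_mxtens (V : nmodType) m n (F : 'I_(m * n) -> V) :
  \sum_q F q = \sum_i \sum_j F (mxtens_index (i, j)).
Proof.
rewrite pair_bigA (reindex (@mxtens_index m n)) /=.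
  by apply: eq_bigr => -[i j] _.
by exists (@mxtens_unindex m n) => q _; rewrite ?mxtens_indexK ?mxtens_unindexK.
Qed.

(** Both sides are the trilinear sum of [h_ijk x_k y_i z_j]; this duality carries information on
    [mode2 H] back to the dynamics. *)
Lemma mode2_tens (R : realType) n (H : 'M[R]_(n, n * n)) (x y z : 'cV[R]_n) :
  z^T *m (mode2 H *m (x *t y)) = y^T *m (H *m (x *t z)).
Proof.
apply/matrixP => a b; rewrite !ord1 {a b} !mxE.
under eq_bigr do rewrite mxE [X in _ * X]mxE sum_mxtens mulr_sumr.
under [RHS]eq_bigr do rewrite mxE [X in _ * X]mxE sum_mxtens mulr_sumr.
under eq_bigr do under eq_bigr do rewrite mulr_sumr.
under [RHS]eq_bigr do under eq_bigr do rewrite mulr_sumr.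
rewrite exchange_big [RHS]exchange_big /=; apply: eq_bigr => k _.
rewrite exchange_big; apply: eq_bigr => i _; apply: eq_bigr => j _.
rewrite !tens_colE /mode2 mxE mxtens_indexK /hessian_tensor /=; ring.
Qed.

Section Observability.
Context {R : realType} {n m p : nat} (sys : qb_system R n m p).

(** The dual equation is fed to [gramian_equation_ker] with the transposed matrices, [S = P],
    [X = Q] and, for each [z] in Ker [Q], the single row [E = z^T]. *)
Lemma observability_kernel (P Q : 'M[R]_n) :
  posdef_mx P -> psd_mx Q -> observability_equation sys P Q ->
  invariant_kernel sys Q /\ forall z : 'cV_n, Q *m z = 0 -> qbC sys *m z = 0.
Proof.
move=> posP psdQ eqQ; have [symQ _] := psdQ.
have ker (z : 'cV_n) : Q *m z = 0 ->
    [/\ z^T *m (qbA sys)^T *m Q = 0, z^T *m mode2 (qbH sys) *m (P *t Q) = 0,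
      forall l, z^T *m (qbN sys l)^T *m Q = 0 & z^T *m (qbC sys)^T = 0].
  move=> Qz; apply: (gramian_equation_ker (posdef_psd posP) psdQ).
    rewrite trmxK trmxK -[RHS]eqQ; congr (_ + _ + _).
    by apply: eq_bigr => l _; rewrite trmxK.
  by rewrite -symQ -trmx_mul Qz trmx0.
have trK k (M : 'M[R]_(n, k)) (z : 'cV[R]_k) : z^T *m M^T *m Q = 0 -> Q *m (M *m z) = 0.
  by move=> /(congr1 trmx); rewrite !trmx_mul !trmxK symQ trmx0.
split=> z /ker[zA zH zN zC]; last by apply: trmx_inj; rewrite trmx_mul zC trmx0.
split=> [|| l]; [exact: trK | | exact: trK].
apply/matrixP => i j; rewrite ord1 [RHS]mxE.
(* Testing against [invmx P *m z] tensored with a basis vector turns [P *t Q] into [z] tensored with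
   a column of [Q]; [mode2_tens] then exhibits an entry of [Q *m (H *m (z *t z))]. *)
have := congr1 (fun M => (M *m ((invmx P *m z) *t (delta_mx i 0 : 'cV_n))) 0 0) zH.
rewrite mul0mx [RHS]mxE => h; rewrite -[RHS]h {h}.
rewrite -(mulmxA (z^T *m mode2 (qbH sys))) (tensmx_mul P Q) mulKVmx ?posdef_unitmx //.
rewrite -(mulmxA z^T) mode2_tens.
by rewrite trmx_mul trmx_delta symQ -(mulmxA (delta_mx 0 i)) -rowE [RHS]mxE.
Qed.

Lemma unobservable_energy0 (P Q : 'M[R]_n) u (x : R -> 'cV[R]_n) :
  posdef_mx P -> psd_mx Q -> observability_equation sys P Q ->
  in_L2 `[0, +oo[ u -> is_trajectory (qb_field_hom sys) `[0, +oo[ u x ->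
  Q *m x 0 = 0 -> energy `[0, +oo[ (fun t => qbC sys *m x t) = 0%E.
Proof.
move=> posP psdQ eqQ L2u trx x0.
have [inv CQ] := observability_kernel posP psdQ eqQ.
rewrite /energy integral0_eq ?mule0 // => t; rewrite /= in_itv /= andbT => t0.
rewrite CQ ?enorm0 ?expr0n //.
apply: (invariant_kernel_trajectory _ _ _ inv L2u trx _ _ t0 x0) => //.
- move=> s r; rewrite /= !in_itv /= => /andP[s0 _] _ q.
  rewrite /= !in_itv /= => /andP[sq _].
  by rewrite (le_trans s0 sq).
- by rewrite /= in_itv /= lexx.
- by rewrite /= in_itv /= t0.
Qed.

End Observability.

Theorem theorem4p5 (R : realType) (n m p : nat) (sys : qb_system R n m p)
    (stableA : stable_mx (qbA sys)) (symH : hessian_sym (qbH sys)) :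
  (forall P : 'M[R]_n,
     is_reachability_gramian sys P -> reachability_equation sys P ->
     forall x0 : 'cV[R]_n, ~ (exists z : 'cV[R]_n, x0 = P *m z) ->
     Lc sys x0 = +oo%E /\ ~ (exists u : R -> 'cV[R]_m, steers_to sys x0 u)) /\
  (forall (P Q : 'M[R]_n) (alpha beta : R), 0 < alpha -> 0 < beta ->
     is_reachability_gramian sys P -> posdef_mx P ->
     is_observability_gramian sys Q ->
     reachability_equation sys P -> observability_equation sys P Q ->
     forall x0 : 'cV[R]_n, Q *m x0 = 0 ->
     Lo sys alpha beta x0 = 0%E).
Proof.
split=> [P gramP eqP x0 x0P|P Q alpha beta _ _ _ posP gramQ _ eqQ x0 Qx0].
  have noinput u : ~ steers_to sys x0 u.
    move=> /(steered_state_in_image stableA (gramian_psd gramP) eqP).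
    exact: x0P.
  split; last by case=> u; exact: noinput.
  (* No input steers to [x0], and the infimum of the empty set is [+oo]. *)
  rewrite /Lc (_ : [set energy _ u | u in _] = set0) ?ereal_inf0 //.
  by rewrite -subset0 => e [u /noinput].
rewrite /Lo; apply/eqP; rewrite eq_le; apply/andP; split.
  apply: ge_ereal_sup => _ [->//|[u [x [[L2u _ _] trx x0E _ ->]]]].
  by rewrite (unobservable_energy0 posP (gramian_psd gramQ) eqQ L2u trx) // x0E.
(* The value 0 adjoined to the output energies gives the lower bound. *)
by apply: ereal_sup_ubound; left.
Qed.
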